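(* Let $n\ge 2$ be an integer (so that $\log\log n$ is defined; logarithms are base $2$). There is an ancestry labeling scheme $(\mathcal{M},\mathcal{D})$ for $\mathcal{T}(n)$ with label size $\lceil\log n\rceil+6\lceil\log\log n\rceil+7$ bits and constant query time. Moreover, given a tree $T\in\mathcal{T}(n)$, the marker assigns the labels to the nodes of $T$ in time linear in $|T|$.
   Context: $\mathcal{T}(n)$ denotes the family of all rooted trees with at most $n$ nodes. In a rooted tree with root $r$, a node $u$ is an ancestor of a node $v$ if $u\neq v$ and $u$ lies on the path from $v$ to $r$. An ancestry labeling scheme $(\mathcal{M},\mathcal{D})$ for $\mathcal{T}(n)$ consists of a marker algorithm $\mathcal{M}$ which, given any $T\in\mathcal{T}(n)$, assigns a label (bit string) $L(u)$ to each node $u$ of $T$, and a decoder algorithm $\mathcal{D}$ which, given any two labels $\ell_1,\ell_2$ in the output domain of $\mathcal{M}$, returns a boolean; the decoder does not know the tree. It is required that for every $T\in\mathcal{T}(n)$ and all nodes $u,v$ of $T$, $\mathcal{D}(L(u),L(v))=1$ if and only if $u$ is an ancestor of $v$ in $T$. The label size is the maximum number of bits in a label assigned by $\mathcal{M}$ to any node of any tree in $\mathcal{T}(n)$. Query time is the running time of $\mathcal{D}$ measured in the RAM model with word length $\Omega(\log n)$ bits. *)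

(* Defs.v *)
From mathcomp Require Import all_boot.

Set Implicit Arguments.
Unset Strict Implicit.
Unset Printing Implicit Defensive.

(* A rooted tree on the node set {0, .., nnodes - 1}.  The parent function is
   made total by letting the root be its own parent; since every node reaches
   the root, the iterates of parent at v are exactly the nodes of the path
   from v to the root. *)
Record rtree := RTree {
  nnodes : nat;
  troot : 'I_nnodes;
  parent : 'I_nnodes -> 'I_nnodes;
  parent_root : parent troot = troot;
  reach_root : forall v, fconnect parent v troot
}.

Definition ancestor (T : rtree) (u v : 'I_(nnodes T)) : bool :=
  (u != v) && fconnect (@parent T) v u.

Record labeling_scheme := LabelingScheme {
  label : forall T : rtree, 'I_(nnodes T) -> bitseq;
  decode : bitseq -> bitseq -> bool
}.

Definition ancestry_scheme (n : nat) (A : labeling_scheme) : Prop :=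
  forall T : rtree, nnodes T <= n ->
  forall u v : 'I_(nnodes T),
    decode A (label A u) (label A v) = true <-> ancestor u v.

Definition output_domain (n : nat) (A : labeling_scheme) (l : bitseq) : Prop :=
  exists2 T : rtree, nnodes T <= n & exists u : 'I_(nnodes T), l = label A u.

Definition has_label_size (n : nat) (A : labeling_scheme) (b : nat) : Prop :=
  (forall l, output_domain n A l -> size l <= b) /\
  (exists2 l, output_domain n A l & size l = b).

(* up_log 2 is the ceiling of the binary logarithm.  For n >= 2 the ceiling of
   log log n is the least e with log n <= 2 ^ e, and since 2 ^ e is an integer
   log n may be rounded up first; clog2log2_le confirms this. *)
Definition clog2 (n : nat) : nat := up_log 2 n.
Definition clog2log2 (n : nat) : nat := clog2 (clog2 n).

Lemma clog2_le n e : 0 < n -> (clog2 n <= e) = (n <= 2 ^ e).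
Proof.
move=> n_gt0; apply/idP/idP => [le_e | le_n]; last exact: up_log_min.
have le_n : n <= 2 ^ up_log 2 n by exact: up_logP.
by apply: leq_trans le_n _; rewrite leq_exp2l.
Qed.

Lemma clog2log2_le n e : 1 < n -> (clog2log2 n <= e) = (n <= 2 ^ (2 ^ e)).
Proof.
move=> n_gt1; have clog_gt0 : 0 < clog2 n by rewrite up_log_gt0.
by rewrite clog2_le // clog2_le // ltnW.
Qed.

(* The RAM with words of w bits; every instruction takes one unit of time. *)
Definition word (w x : nat) : nat := x %% 2 ^ w.

Inductive binop :=
  | OAdd | OSub | OMul | ODiv | OMod | OShl | OShr | OAnd | OOr | OXor | OLt | OEq.

(* Subtraction is truncated at 0; division by 0 yields quotient 0. *)
Definition eval_binop (o : binop) (x y : nat) : nat :=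
  match o with
  | OAdd => x + y
  | OSub => x - y
  | OMul => x * y
  | ODiv => x %/ y
  | OMod => x %% y
  | OShl => x * 2 ^ y
  | OShr => x %/ 2 ^ y
  | OAnd => Nat.land x y
  | OOr => Nat.lor x y
  | OXor => Nat.lxor x y
  | OLt => x < y
  | OEq => x == y
  end.

(* In ILoad d a and IStore a s the register a holds the memory address. *)
Inductive instr :=
  | IConst (d c : nat)
  | IOp (o : binop) (d r1 r2 : nat)
  | ILoad (d a : nat)
  | IStore (a s : nat)
  | IJump (l : nat)
  | IJumpZ (r l : nat).

Definition program := seq instr.

Record config := Config {
  pc : nat;
  regs : nat -> nat;
  memory : nat -> nat
}.

Definition upd (f : nat -> nat) (a x : nat) : nat -> nat :=
  fun b => if b == a then x else f b.

Definition exec (w : nat) (i : instr) (c : config) : config :=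
  let: Config p R M := c in
  match i with
  | IConst d k => Config p.+1 (upd R d (word w k)) M
  | IOp o d r1 r2 =>
      Config p.+1 (upd R d (word w (eval_binop o (R r1) (R r2)))) M
  | ILoad d a => Config p.+1 (upd R d (M (R a))) M
  | IStore a s => Config p.+1 R (upd M (R a) (R s))
  | IJump l => Config l R M
  | IJumpZ r l => Config (if R r == 0 then l else p.+1) R M
  end.

(* The machine halts when the program counter leaves the program.  A halted
   configuration is a fixed point of step, so "halted after iterating t times"
   means "running time at most t". *)
Definition halted (P : program) (c : config) : bool := size P <= pc c.

Definition step (w : nat) (P : program) (c : config) : config :=
  if onth P (pc c) is Some i then exec w i c else c.

Definition run (w : nat) (P : program) (t : nat) (c : config) : config :=
  iter t (step w P) c.

(* A bit string is held in one word, as the binary numeral obtained by putting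
   a leading 1 in front of it (so that its length can be recovered). *)
Definition code (l : bitseq) : nat := foldl (fun a (b : bool) => a.*2 + b) 1 l.

(* Input of the decoder: the two labels, in registers 0 and 1. *)
Definition decoder_input (w : nat) (l1 l2 : bitseq) : config :=
  Config 0 (fun r => match r with
                     | 0 => word w (code l1)
                     | 1 => word w (code l2)
                     | _ => 0
                     end)
           (fun=> 0).

(* Input of the marker: the number of nodes in register 0, and the parent of
   each node v in memory cell v. *)
Definition marker_input (w : nat) (T : rtree) : config :=
  Config 0 (fun r => if r == 0 then word w (nnodes T) else 0)
           (fun a => if insub a is Some v then word w (parent (r := T) v) else 0).

Definition decoder_runs_in (w n : nat) (A : labeling_scheme) (P : program)
    (t : nat) : Prop :=
  forall l1 l2, output_domain n A l1 -> output_domain n A l2 ->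
  let c := run w P t (decoder_input w l1 l2) in
  halted P c /\ regs c 0 = decode A l1 l2.

(* Output of the marker: the label of each node v in memory cell v. *)
Definition marker_runs_in (w n : nat) (A : labeling_scheme) (P : program)
    (t : nat -> nat) : Prop :=
  forall T : rtree, nnodes T <= n ->
  let c := run w P (t (nnodes T)) (marker_input w T) in
  halted P c /\ forall v : 'I_(nnodes T), memory c v = code (label A v).

(* Main.v *)
Require Import Defs.
From mathcomp Require Import all_boot zify.
From Stdlib Require Import FunctionalExtensionality.

Set Implicit Arguments.
Unset Strict Implicit.
Unset Printing Implicit Defensive.

(* Call the child with the longest interval heavy and the others light.  Every
   node [v] gets a position and an interval of [len v] numbers starting there;
   the light children follow [v] one after the other, and the heavy child comes
   last, so that its interval ends where the interval of [v] ends.  An interval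
   is described by its start and by the length rounded up to a floating-point
   number with a mantissa of about log log n bits.  Rounding may make it
   overshoot, but only into the gap of [slack (len c)] numbers left free after
   every light child [c], and rounding errors along heavy paths do not add up
   because their intervals share the right end.  A path from the root has at
   most about log n light edges and each gap is a fraction 1 / O(log n) of its
   interval, so the positions remain below 2n.

   The marker peels leaves off the tree with a queue to compute the lengths
   bottom-up, and then assigns the positions in the reverse order.  Its run is
   shown free of overflow for words of [20 * clog2 n] bits, hence it is the same
   for all longer words, and the labels are defined as what it computes. *)

(** * A program logic for the RAM *)

Inductive ainstr :=
  | AConst (d c : nat)
  | AOp (o : binop) (d r1 r2 : nat)
  | ALoad (d j a : nat)
  | AStore (j a s : nat).

(* The loop [For s] runs [s] while register 1 is below register 0; register 19
   holds the outcome of the test, and register 20 the address of a memory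
   access. *)
Inductive stmt :=
  | Block (s : seq ainstr)
  | For (s : seq ainstr).

Section ProgramLogic.

(* Arrays have [B] cells: cell [a] of array [j] is at address [j * B + a]. *)
Variables (B W : nat).

Definition compile_ainstr (i : ainstr) : seq instr :=
  match i with
  | AConst d c => [:: IConst d c]
  | AOp o d r1 r2 => [:: IOp o d r1 r2]
  | ALoad d j a => [:: IConst 20 (j * B); IOp OAdd 20 20 a; ILoad d 20]
  | AStore j a s => [:: IConst 20 (j * B); IOp OAdd 20 20 a; IStore 20 s]
  end.

Definition compile_block (s : seq ainstr) : seq instr :=
  flatten (map compile_ainstr s).

Fixpoint compile (p : nat) (l : seq stmt) : program :=
  match l with
  | [::] => [::]
  | Block s :: l' =>
      compile_block s ++ compile (p + size (compile_block s)) l'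
  | For s :: l' =>
      let e := p + (size (compile_block s) + 3) in
      [:: IOp OLt 19 1 0; IJumpZ 19 e] ++ compile_block s ++ IJump p ::
      compile e l'
  end.

Definition flat (F : nat -> nat -> nat) : nat -> nat :=
  fun a => F (a %/ B) (a %% B).

Definition upd2 (F : nat -> nat -> nat) (j a x : nat) : nat -> nat -> nat :=
  fun j' a' => if (j' == j) && (a' == a) then x else F j' a'.

Definition assertion := (nat -> nat) -> (nat -> nat -> nat) -> Prop.

(* The bounds by [2 ^ W] exclude overflow, so that the computation is the same
   for all word lengths from [W] on. *)
Fixpoint wp (s : seq ainstr) (Q : assertion) : assertion :=
  match s with
  | [::] => Q
  | AConst d c :: s' => fun R F =>
      c < 2 ^ W /\ wp s' Q (upd R d c) F
  | AOp o d r1 r2 :: s' => fun R F =>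
      forall x, x = eval_binop o (R r1) (R r2) ->
      x < 2 ^ W /\ wp s' Q (upd R d x) F
  | ALoad d j a :: s' => fun R F =>
      [/\ a != 20, R a < B, j < 9
        & forall x, x = F j (R a) ->
          wp s' Q (upd (upd R 20 (j * B + R a)) d x) F]
  | AStore j a s :: s' => fun R F =>
      [/\ (a != 20) && (s != 20), R a < B, j < 9
        & wp s' Q (upd R 20 (j * B + R a)) (upd2 F j (R a) (R s))]
  end.

Lemma wp_nil (Q : assertion) R F : Q R F -> wp [::] Q R F.
Proof. by []. Qed.

Lemma wp_const d c s Q R F :
  c < 2 ^ W -> wp s Q (upd R d c) F -> wp (AConst d c :: s) Q R F.
Proof. by []. Qed.

(** The result [x] is supplied explicitly, so that registers are recorded by their mathematical
    meaning and not by a growing term of machine operations. *)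
Lemma wp_op x o d r1 r2 s Q R F :
  eval_binop o (R r1) (R r2) = x -> x < 2 ^ W -> wp s Q (upd R d x) F ->
  wp (AOp o d r1 r2 :: s) Q R F.
Proof. by move=> <- hx h _ ->. Qed.

Lemma wp_load y x d j a s Q R F :
  a != 20 -> j < 9 -> R a = y -> y < B -> F j y = x ->
  wp s Q (upd (upd R 20 (j * B + y)) d x) F ->
  wp (ALoad d j a :: s) Q R F.
Proof. by move=> ha hj Ey hy <- h; split; rewrite ?Ey // => _ ->. Qed.

Lemma wp_store y x j a s s' Q R F :
  (a != 20) && (s != 20) -> j < 9 -> R a = y -> y < B -> R s = x ->
  wp s' Q (upd R 20 (j * B + y)) (upd2 F j y x) ->
  wp (AStore j a s :: s') Q R F.
Proof. by move=> ha hj Ey hy Ex h; split; rewrite ?Ey ?Ex. Qed.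

(** One final configuration must serve for every word length from [W] on; this is what lets a run at
    a single word length define the labels. *)
Definition reaches (P : program) (t : nat) (c c' : config) : Prop :=
  forall w, W <= w -> run w P t c = c'.

Definition triple (P : program) (t p : nat) (R : nat -> nat)
    (F : nat -> nat -> nat) (p' : nat) (Q : assertion) : Prop :=
  exists R' F', Q R' F' /\
    exists2 t', t' <= t &
      reaches P t' (Config p R (flat F)) (Config p' R' (flat F')).

Lemma reaches_trans P t1 t2 c1 c2 c3 :
  reaches P t1 c1 c2 -> reaches P t2 c2 c3 -> reaches P (t1 + t2) c1 c3.
Proof.
move=> h1 h2 w hw; rewrite /run addnC iterD.
by have := h1 w hw; rewrite /run => ->; exact: h2.
Qed.

Lemma reaches_step P i p R M c' : onth P p = Some i ->
  (forall w, W <= w -> exec w i (Config p R M) = c') ->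
  reaches P 1 (Config p R M) c'.
Proof. by move=> hi he w hw; rewrite /run /iter /step hi he. Qed.

Lemma triple_bind P t1 t2 p1 p2 p3 R F (Q1 Q2 : assertion) :
  triple P t1 p1 R F p2 Q1 ->
  (forall R' F', Q1 R' F' -> triple P t2 p2 R' F' p3 Q2) ->
  triple P (t1 + t2) p1 R F p3 Q2.
Proof.
move=> [R1 [F1 [h1 [s1 le1 r1]]]] /(_ _ _ h1) [R2 [F2 [h2 [s2 le2 r2]]]].
exists R2, F2; split=> //; exists (s1 + s2); first exact: leq_add.
exact: reaches_trans r1 r2.
Qed.

Lemma triple_return P p R F (Q : assertion) : Q R F -> triple P 0 p R F p Q.
Proof. by move=> h; exists R, F; split=> //; exists 0. Qed.

Lemma word_small w x : W <= w -> x < 2 ^ W -> word w x = x.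
Proof.
by move=> hw hx; rewrite /word modn_small // (leq_trans hx) // leq_exp2l.
Qed.

Lemma upd_upd R d x y : upd (upd R d x) d y = upd R d y.
Proof. by apply: functional_extensionality => r; rewrite /upd; case: eqP. Qed.

Lemma flat_upd2 F j a x : a < B ->
  upd (flat F) (j * B + a) x = flat (upd2 F j a x).
Proof.
move=> ha; apply: functional_extensionality => b; rewrite /upd /flat /upd2.
have B_gt0 : 0 < B by exact: leq_ltn_trans ha.
have -> : (b == j * B + a) = (b %/ B == j) && (b %% B == a); last by [].
apply/eqP/andP => [-> | [/eqP <- /eqP <-]]; last exact: divn_eq.
by rewrite divnMDl // divn_small // addn0 modnMDl modn_small.
Qed.

Lemma flat_arr F j a : a < B -> flat F (j * B + a) = F j a.
Proof.
move=> ha; have B_gt0 : 0 < B by exact: leq_ltn_trans ha.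
by rewrite /flat divnMDl // divn_small // addn0 modnMDl modn_small.
Qed.

Hypothesis B_small : 9 * B <= 2 ^ W.

(** Loads and stores share their first two instructions, so the third, [i], is left open. Register
    20 is overwritten before [a] is read, hence [a != 20]. *)
Lemma array_address P p R F j a i : a != 20 -> R a < B -> j < 9 ->
  (forall k, k < 3 -> onth P (p + k) =
     onth [:: IConst 20 (j * B); IOp OAdd 20 20 a; i] k) ->
  reaches P 2 (Config p R (flat F))
              (Config p.+2 (upd R 20 (j * B + R a)) (flat F)).
Proof.
move=> a20 ha hj hP.
apply: (@reaches_trans _ 1 1 _ (Config p.+1 (upd R 20 (j * B)) (flat F))).
  apply: reaches_step => [|w hw]; first by rewrite -[p]addn0 hP.
  by rewrite /= word_small //; nia.
apply: reaches_step => [|w hw]; first by rewrite -addn1 hP.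
rewrite /= upd_upd /upd /= (negbTE a20) word_small //; nia.
Qed.

Lemma wp_sound s Q P pre post R F :
  P = pre ++ compile_block s ++ post -> wp s Q R F ->
  triple P (size (compile_block s)) (size pre) R F
           (size pre + size (compile_block s)) Q.
Proof.
elim: s pre R F => [|i s IH] pre R F.
  by move=> _ h; rewrite addn0; apply: triple_return.
rewrite /compile_block /= -/(compile_block s) -!catA => hP.
have hon k : k < size (compile_ainstr i) ->
    onth P (size pre + k) = onth (compile_ainstr i) k.
  move=> hk; rewrite hP onth_cat ltnNge leq_addr /= addKn.
  by rewrite onth_cat hk.
have IH' R' F' : wp s Q R' F' ->
    triple P (size (compile_block s)) (size pre + size (compile_ainstr i)) R' F'
           (size pre + size (compile_ainstr i ++ compile_block s)) Q.
  have := IH (pre ++ compile_ainstr i) R' F'; rewrite !size_cat addnA.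
  by apply; rewrite hP -!catA.
suff H : wp (i :: s) Q R F -> exists R' F', wp s Q R' F' /\
    reaches P (size (compile_ainstr i)) (Config (size pre) R (flat F))
      (Config (size pre + size (compile_ainstr i)) R' (flat F')).
  rewrite {1}size_cat => /H [R' [F' [h r]]]; apply: (triple_bind _ IH').
  by exists R', F'; split=> //; exists (size (compile_ainstr i)).
case: i hP hon {IH'} => [d c|o d r1 r2|d j a|j a s'] hP hon /=.
- case=> hc h; exists (upd R d c), F; split=> //.
  apply: reaches_step => [|w hw]; first by rewrite -[size pre]addn0 hon.
  by rewrite /= word_small // addn1.
- move=> /(_ _ erefl) [hc h]; exists (upd R d (eval_binop o (R r1) (R r2))), F.
  split=> //.
  apply: reaches_step => [|w hw]; first by rewrite -[size pre]addn0 hon.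
  by rewrite /= word_small // addn1.
- case=> a20 ha hj /(_ _ erefl) h; do 2 eexists; split; first exact: h.
  apply: reaches_trans (array_address F a20 ha hj hon) _.
  apply: reaches_step => [|w hw]; first by rewrite -addn2 hon.
  by rewrite /= addn3 {2}/upd /= flat_arr.
- case=> /andP[a20 s20] ha hj h; do 2 eexists; split; first exact: h.
  apply: reaches_trans (array_address F a20 ha hj hon) _.
  apply: reaches_step => [|w hw]; first by rewrite -addn2 hon.
  rewrite /= addn3 -flat_upd2 //; congr Config.
  by rewrite [X in upd _ X _]/upd [X in upd _ _ X]/upd /= (negbTE s20).
Qed.

(** The invariant pins registers 0 and 1 so that the test can be evaluated. The body increments
    register 1 itself, and it starts with the positive outcome of the test in register 19. *)
Definition for_rule (N : nat) (s : seq ainstr) (Inv : nat -> assertion) : Prop :=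
  (forall k R F, Inv k R F -> R 0 = N /\ R 1 = k) /\
  (forall k R F, k < N -> Inv k R F -> wp s (Inv k.+1) (upd R 19 1) F).

Fixpoint wps (N : nat) (l : seq stmt) (Q : assertion) : assertion :=
  match l with
  | [::] => Q
  | Block s :: l' => wp s (wps N l' Q)
  | For s :: l' => fun R F => exists Inv : nat -> assertion,
      [/\ Inv 0 R F, for_rule N s Inv
        & forall R' F', Inv N R' F' -> wps N l' Q (upd R' 19 0) F']
  end.

Lemma wps_block N s l Q R F :
  wp s (wps N l Q) R F -> wps N (Block s :: l) Q R F.
Proof. by []. Qed.

Lemma wps_for N s l Q R F Inv : Inv 0 R F -> for_rule N s Inv ->
  (forall R' F', Inv N R' F' -> wps N l Q (upd R' 19 0) F') ->
  wps N (For s :: l) Q R F.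
Proof. by move=> h0 hr hQ; exists Inv. Qed.

(** An iteration costs two steps for the test, the body, and one jump back. The failing test at the
    end costs two steps and is charged as one further iteration. *)
Lemma for_sound N s Inv P pre post R F (Q : assertion) :
  let e := size pre + (size (compile_block s) + 3) in
  P = pre ++ [:: IOp OLt 19 1 0; IJumpZ 19 e] ++ compile_block s ++
      IJump (size pre) :: post ->
  0 < W -> for_rule N s Inv -> Inv 0 R F ->
  (forall R' F', Inv N R' F' -> Q (upd R' 19 0) F') ->
  triple P ((size (compile_block s) + 3) * N.+1) (size pre) R F e Q.
Proof.
move=> e hP W_gt0 [hreg hbody] h0 hQ.
have W_gt1 : 1 < 2 ^ W by rewrite -{1}(expn0 2) ltn_exp2l.
set b := size (compile_block s) in e hP *.
have hon k : onth P (size pre + k) = onth ([:: IOp OLt 19 1 0; IJumpZ 19 e] ++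
    compile_block s ++ IJump (size pre) :: post) k.
  by rewrite hP onth_cat ltnNge leq_addr /= addKn.
have test k R' F' : Inv k R' F' ->
    reaches P 2 (Config (size pre) R' (flat F'))
      (Config (if k < N then (size pre).+2 else e) (upd R' 19 (k < N)) (flat F')).
  move=> /hreg [hN hk]; apply: (@reaches_trans _ 1 1 _
    (Config (size pre).+1 (upd R' 19 (k < N)) (flat F'))).
    apply: reaches_step => [|w hw]; first by rewrite -[size pre]addn0 hon.
    by rewrite /= hN hk word_small //; apply: leq_ltn_trans W_gt1; case: (_ < _).
  apply: reaches_step => [|w hw]; first by rewrite -addn1 hon.
  by rewrite /= {1}/upd /=; case: (_ < _).
have iter_body k : k <= N ->
    triple P ((b + 3) * k) (size pre) R F (size pre) (Inv k).
  elim: k => [|k IHk] hk; first by rewrite muln0; apply: triple_return.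
  rewrite mulnS addnC; apply: triple_bind (IHk (ltnW hk)) _ => R' F' hI.
  have -> : b + 3 = 2 + (b + 1) by lia.
  apply: (@triple_bind _ _ _ _ (size pre).+2 _ _ _
    (fun R1 F1 => R1 = upd R' 19 1 /\ F1 = F')).
    by do 2 eexists; split; last (exists 2 => //; have := test _ _ _ hI; rewrite hk).
  move=> _ _ [-> ->]; have := hbody _ _ _ hk hI.
  have hP' : P = (pre ++ [:: IOp OLt 19 1 0; IJumpZ 19 e]) ++ compile_block s ++
    IJump (size pre) :: post by rewrite hP -!catA.
  move=> /(wp_sound hP'); rewrite size_cat /= !addn2 => hs.
  apply: triple_bind hs _ => R2 F2 hI2; exists R2, F2; split=> //; exists 1 => //.
  apply: (@reaches_step _ (IJump (size pre))) => [|//].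
  rewrite -/b; have -> : (size pre).+2 + b = size pre + (2 + b) by lia.
  by rewrite hon /= onth_cat ltnn subnn.
rewrite mulnS addnC; apply: triple_bind (iter_body N (leqnn _)) _ => R' F' hI.
exists (upd R' 19 0), F'; split; first exact: hQ.
exists 2; first by rewrite addn3.
by have := test _ _ _ hI; rewrite ltnn.
Qed.

(** All loops have the same number [N] of iterations, so every instruction is charged [N.+1] times,
    also those outside the loops. *)
Lemma wps_sound N l Q P pre R F :
  P = pre ++ compile (size pre) l -> 0 < W -> wps N l Q R F ->
  triple P (size (compile (size pre) l) * N.+1) (size pre) R F (size P) Q.
Proof.
elim: l pre R F => [|[] s l IH] pre R F /=.
- by move=> -> _ h; rewrite cats0; apply: triple_return.
- move=> hP W_gt0 h; rewrite size_cat mulnDl.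
  have := wp_sound hP h => hs; have {}hs : triple P (size (compile_block s) * N.+1)
      (size pre) R F (size pre + size (compile_block s)) (wps N l Q).
    case: hs => R' [F' [h' [t ht r]]]; exists R', F'; split=> //; exists t => //.
    by rewrite mulnS (leq_trans ht) // leq_addr.
  apply: triple_bind hs _ => R' F' h'.
  have := IH (pre ++ compile_block s) R' F'; rewrite size_cat; apply=> //.
  by rewrite hP -catA.
- set e := size pre + _; move=> hP W_gt0 [Inv [h0 hr hQ]].
  have := for_sound hP W_gt0 hr h0 hQ => hs.
  have -> : (size (compile_block s ++ IJump (size pre) :: compile e l)).+2 =
      (size (compile_block s) + 3) + size (compile e l) by rewrite size_cat /=; lia.
  rewrite mulnDl; apply: triple_bind hs _ => R' F' h'.
  have he : size (pre ++ [:: IOp OLt 19 1 0; IJumpZ 19 e] ++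
    compile_block s ++ [:: IJump (size pre)]) = e by rewrite !size_cat /= /e; lia.
  have := IH (pre ++ [:: IOp OLt 19 1 0; IJumpZ 19 e] ++
    compile_block s ++ [:: IJump (size pre)]) R' F'; rewrite he; apply=> //.
  by rewrite hP -!catA.
Qed.

Lemma run_halted w P t c : halted P c -> run w P t c = c.
Proof.
move=> h; elim: t => //= t ->.
by rewrite /step onth_default.
Qed.

Lemma program_sound N l Q R F t :
  let P := compile 0 l in
  0 < W -> wps N l Q R F -> size P * N.+1 <= t ->
  exists R' F', [/\ Q R' F',
    reaches P t (Config 0 R (flat F)) (Config (size P) R' (flat F'))
    & halted P (Config (size P) R' (flat F'))].
Proof.
move=> P W_gt0 h ht.
have := @wps_sound N l Q P [::] R F erefl W_gt0 h.
move=> [R' [F' [h' [s hs r]]]]; exists R', F'; split=> //; last exact: leqnn.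
have le_s : s <= t by exact: leq_trans ht.
rewrite -(subnKC le_s); apply: reaches_trans r _ => w _.
by rewrite run_halted /halted //=.
Qed.

End ProgramLogic.

Ltac read_regs :=
  rewrite /upd /=; repeat match goal with H : ?R (_ : nat) = _ |- _ =>
    is_var R; rewrite H end.
(** Symbolic execution, one instruction per tactic: [xop] takes the resulting value, [xload] and
    [xstore] take the cell and the value; range conditions are tried with [lia]. *)
Ltac xconst := apply: wp_const; [try lia | ].
Ltac xop x := apply: (@wp_op _ _ x); [read_regs | try lia | ].
Ltac xload y x :=
  apply: (@wp_load _ _ y x); [by [] | by [] | read_regs; try by [] | try lia | | ].
Ltac xstore y x :=
  apply: (@wp_store _ _ y x);
  [by [] | by [] | read_regs; try by [] | try lia | read_regs; try by [] | ].

(** * Interval lengths *)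

(** Describes the effect of handling one more child [v]: with [addn] for padded sums and counts,
    with [maxn] for keys. *)
Lemma big_add1_seq (T : Type) (idx : T) (op : Monoid.com_law idx) (I : eqType)
    (s : seq I) (A A' : pred I) (v : I) (f : I -> T) :
  uniq s -> (forall c, A' c = (c == v) || A c) -> ~~ A v ->
  \big[op/idx]_(c <- s | A' c) f c =
  op (\big[op/idx]_(c <- s | A c) f c) (if v \in s then f v else idx).
Proof.
move=> us hA Av.
have -> : (if v \in s then f v else idx) = \big[op/idx]_(c <- s | c == v) f c.
  elim: s us => [|x s IH] /=; first by rewrite big_nil.
  case/andP=> xs us; rewrite big_cons inE -(IH us) [v == x]eq_sym.
  by case: eqP => //= E; rewrite -E (negbTE xs) Monoid.mulm1.
rewrite [X in op X]big_mkcond [X in op _ X]big_mkcond -big_split /= big_mkcond.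
apply: eq_bigr => c _; rewrite hA; case: (eqVneq c v) => [->|_] /=.
  by rewrite (negbTE Av) Monoid.mul1m.
by rewrite Monoid.mulm1.
Qed.

(* The nodes are 0, .., m - 1; the parent of the root is the dummy node m. *)
Record rooted (m rt : nat) (par d : nat -> nat) : Prop := Rooted {
  rooted_lt : rt < m;
  rooted_dummy : par rt = m;
  rooted_depth0 : d rt = 0;
  rooted_par_lt : forall v, v < m -> v != rt -> par v < m;
  rooted_depth : forall v, v < m -> v != rt -> d v = (d (par v)).+1
}.

Section Tree.

Variables (m rt : nat) (par d : nat -> nat).
Hypothesis tree : rooted m rt par d.
Let rt_lt : rt < m := rooted_lt tree.
Let par_rt : par rt = m := rooted_dummy tree.
Let d_rt : d rt = 0 := rooted_depth0 tree.
Let par_lt v : v < m -> v != rt -> par v < m := @rooted_par_lt _ _ _ _ tree v.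
Let d_par v : v < m -> v != rt -> d v = (d (par v)).+1 := @rooted_depth _ _ _ _ tree v.

(** * Children, depth and subtree sizes *)

Definition children (u : nat) : seq nat := [seq c <- iota 0 m | par c == u].

Lemma mem_children u c : (c \in children u) = (c < m) && (par c == u).
Proof. by rewrite mem_filter mem_iota add0n andbC. Qed.

Lemma uniq_children u : uniq (children u).
Proof. exact/filter_uniq/iota_uniq. Qed.

Lemma child_neq_root u c : u < m -> c \in children u -> c != rt.
Proof.
rewrite mem_children => hu /andP[_ /eqP hc]; apply/eqP => E.
by move: hu; rewrite -hc E par_rt ltnn.
Qed.

Lemma d_child u c : u < m -> c \in children u -> d c = (d u).+1.
Proof.
move=> hu hc; have := child_neq_root hu hc; move: hc; rewrite mem_children.
by case/andP=> hc /eqP <-; apply: d_par.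
Qed.

Lemma children_dummy : children m = [:: rt].
Proof.
apply: perm_small_eq => //; apply: uniq_perm (uniq_children m) _ _ => // v.
rewrite mem_children inE; apply/andP/eqP => [[hv /eqP E]|->]; last first.
  by rewrite par_rt eqxx.
by apply/eqP; apply: contraT => /(par_lt hv); rewrite E ltnn.
Qed.

Definition max_depth : nat := \max_(v < m) d v.

Lemma d_le_max v : v < m -> d v <= max_depth.
Proof. by move=> hv; apply: (@leq_bigmax _ (fun i : 'I_m => d i) (Ordinal hv)). Qed.

Lemma bottom_up_ind (P : nat -> Prop) :
  (forall u, u < m -> (forall c : nat, c \in children u -> P c) -> P u) ->
  forall u, u < m -> P u.
Proof.
move=> IH u; have [k] := ubnP (max_depth - d u); elim: k u => // k IHk u hk hu.
apply: (IH u hu) => c hc; have := d_child hu hc => hd.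
have hcm : c < m by move: hc; rewrite mem_children => /andP[].
apply: IHk => //; have := d_le_max hcm; lia.
Qed.

Lemma top_down_ind (P : nat -> Prop) :
  P rt -> (forall v, v < m -> v != rt -> P (par v) -> P v) ->
  forall v, v < m -> P v.
Proof.
move=> Prt IH v; have [k] := ubnP (d v); elim: k v => // k IHk v hk hv.
case: (eqVneq v rt) => [-> //|v_rt]; apply: IH => //.
by apply: IHk (par_lt hv v_rt); rewrite -ltnS -d_par.
Qed.

(** For a node [v], [d v] steps lead exactly to the root, so the list is the path to the root
    without the dummy. *)
Definition below (u v : nat) : bool := u \in traject par v (d v).+1.

Lemma below_root u : below u rt = (u == rt).
Proof. by rewrite /below d_rt inE. Qed.

Lemma below_par u v : v < m -> v != rt ->
  below u v = (u == v) || below u (par v).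
Proof. by move=> hv v_rt; rewrite /below d_par //= inE. Qed.

Lemma below_refl u : below u u.
Proof. by rewrite /below /= inE eqxx. Qed.

Lemma below_depth u v : v < m -> below u v -> (u == v) || (d u < d v).
Proof.
move: v; apply: top_down_ind => [|v hv v_rt IH].
  by rewrite below_root => ->.
rewrite below_par // => /orP[-> //|/IH /orP[/eqP->|h]]; rewrite (d_par hv v_rt).
  by rewrite ltnSn orbT.
by rewrite ltnS ltnW ?orbT.
Qed.

Definition subtree_size (v : nat) : nat := \sum_(u <- iota 0 m) below v u.

(** Stated as an equation in [nat], which also says that [u] lies below at most one child of [v];
    summing over [u] gives the recursion for subtree sizes. *)
Lemma below_children v u : v < m -> u < m ->
  (below v u : nat) = (v == u) + \sum_(c <- children v) below c u.
Proof.
move=> hv; move: u; apply: top_down_ind => [|u hu u_rt IH].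
  rewrite below_root big1_seq ?addn0 // => c /andP[_ hc].
  by rewrite below_root (negbTE (child_neq_root hv hc)).
have below_c c : c \in children v -> below c u = (c == u) + below c (par u) :> nat.
  move=> hc; rewrite below_par //; case: eqP => //= ->.
  case: (boolP (below u (par u))) => // h.
  have := below_depth (par_lt hu u_rt) h; have := d_par hu u_rt.
  by case: eqP => [/(congr1 d)|_]; lia.
rewrite big_seq (eq_bigr _ (fun c hc => below_c c hc)) -big_seq big_split /=.
rewrite below_par //; case: (eqVneq v u) => [E|v_u] /=.
  rewrite big1_seq ?big1_seq //.
    move=> c /andP[_ hc]; have := d_child hv hc; rewrite E => hd.
    case: (boolP (below _ _)) => // /(below_depth (par_lt hu u_rt)).
    by have := d_par hu u_rt; case: eqP => [/(congr1 d)|_]; lia.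
  move=> c /andP[_ hc]; have := d_child hv hc; rewrite E.
  by case: eqP => // /(congr1 d); lia.
rewrite add0n IH; congr (_ + _).
(* The summand [v == par u] of the induction hypothesis accounts for the one child of [v] that is
   [u] itself. *)
have -> : (v == par u) = (u \in children v) by rewrite mem_children hu eq_sym.
rewrite -big_mkcond /= sum1_count -count_uniq_mem ?uniq_children //.
Qed.

Lemma subtree_size_eq v : v < m ->
  subtree_size v = 1 + \sum_(c <- children v) subtree_size c.
Proof.
move=> hv; rewrite exchange_big /= /subtree_size.
rewrite (eq_big_seq (fun u => (v == u) + \sum_(c <- children v) below c u)).
  rewrite big_split /=; congr (_ + _).
  by rewrite -big_mkcond /= sum1_count (eq_count (eq_sym v))
    count_uniq_mem ?iota_uniq // mem_iota hv.
by move=> u; rewrite mem_iota => /= hu; apply: below_children.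
Qed.

Lemma subtree_size_le v : subtree_size v <= m.
Proof.
rewrite /subtree_size -[X in _ <= X]muln1 -[X in X * _](size_iota 0 m).
rewrite -sum1_size big_distrl /=; apply: leq_sum => u _; exact: leq_b1.
Qed.

(* A node stands for an interval of [len v] consecutive numbers; a child other
   than the one of maximal length gets [padded (len c)] of them.  The key of a
   node encodes both the maximal length and the child attaining it. *)
Variables (B q : nat).
Hypotheses (m_lt_B : m < B).

Definition slack (x : nat) : nat := x %/ 2 ^ q.
Definition padded (x : nat) : nat := x + slack x.

Definition max_key (f : nat -> nat) (s : seq nat) : nat :=
  \max_(c <- s) (f c * B + c).
Definition len_of_children (f : nat -> nat) (s : seq nat) : nat :=
  (\sum_(c <- s) padded (f c)).+1 - slack (max_key f s %/ B).

Fixpoint len_rec (k v : nat) : nat :=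
  if k is k'.+1 then len_of_children (len_rec k') (children v) else 1.

Definition len (v : nat) : nat := len_rec (max_depth - d v) v.
Definition key (v : nat) : nat := max_key len (children v).
(** This is the comparison the machine makes. Ties between children of equal length go to the larger
    index, so each inner node has exactly one heavy child. *)
Definition heavy (v : nat) : bool := key (par v) == len v * B + v.

(** The fuel [max_depth - d v] drops by exactly one on the way to a child, so the recursive calls
    agree with [len]. *)
Lemma lenE v : v < m ->
  len v = (\sum_(c <- children v) padded (len c)).+1 - slack (key v %/ B).
Proof.
move=> hv; rewrite -/(len_of_children len (children v)) /len.
have hd c : c \in children v -> max_depth - d v = (max_depth - d c).+1.
  move=> hc; have := d_child hv hc.
  have /d_le_max : c < m by move: hc; rewrite mem_children => /andP[].
  lia.
(* A leaf has length 1 whether or not fuel is left: the sum is empty and the key is 0. *)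
case E: (children v) => [|c0 s0].
  case: (_ - _) => [|k] /=; rewrite ?E /len_of_children /max_key !big_nil //.
  by rewrite div0n /slack div0n.
rewrite -E (hd c0) ?E ?mem_head // -E /=.
have hk c : c \in children v -> max_depth - d c0 = max_depth - d c.
  move=> hc; have := hd c hc; have := hd c0; rewrite E mem_head => /(_ isT); lia.
rewrite /len_of_children /max_key; congr (_.+1 - slack (_ %/ B)).
  by apply: eq_big_seq => c /hk ->.
by apply: eq_big_seq => c /hk ->.
Qed.

Lemma heavy_child v : v <= m -> children v != [::] ->
  exists h : nat, [/\ h \in children v, key v = len h * B + h, key v %/ B = len h
    & forall c : nat, c \in children v -> len c <= len h].
Proof.
move=> hv; rewrite /key /max_key; move: (@mem_children v).
case: (children v) => // c0 s hs _.
have [h hh E] : exists2 h : nat, h \in c0 :: s &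
    \max_(c <- c0 :: s) (len c * B + c) = len h * B + h.
  elim: (s) c0 {hs} => [|c1 s' IH] c0.
    by exists c0; rewrite ?mem_head // big_seq1.
  have [h hh E] := IH c1; rewrite big_cons E.
  case: (leqP (len c0 * B + c0) (len h * B + h)) => hle.
    by exists h; rewrite // inE hh orbT.
  by exists c0; rewrite ?mem_head.
have lt_B c : c \in c0 :: s -> c < B.
  by rewrite hs => /andP[/ltn_trans -> //].
have B_gt0 : 0 < B by exact: leq_ltn_trans m_lt_B.
have divB c : c \in c0 :: s -> (len c * B + c) %/ B = len c.
  by move=> /lt_B hc; rewrite divnMDl // divn_small ?addn0.
exists h; split=> //; first by rewrite E divB.
move=> c hc; rewrite -(divB h hh) -(divB c hc) -E; apply: leq_div2r.
exact: (leq_bigmax_seq (F := fun c => len c * B + c)).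
Qed.

(** A key determines its child, whose index is the remainder modulo [B]. *)
Lemma heavyP v h c : key v = len h * B + h -> h \in children v ->
  c \in children v -> heavy c = (c == h).
Proof.
rewrite /heavy !mem_children => E /andP[hh _] /andP[hc /eqP ->].
rewrite E eq_sym; apply/eqP/eqP => [E'|-> //].
have modB x : x < m -> (len x * B + x) %% B = x.
  by move=> hx; rewrite modnMDl modn_small // (ltn_trans hx).
by rewrite -(modB c hc) E' modB.
Qed.

Lemma len_heavy v h : v < m -> h \in children v -> key v %/ B = len h ->
  len v = 1 + len h + \sum_(c <- children v | c != h) padded (len c).
Proof.
move=> hv hh E; rewrite lenE // E (bigD1_seq h) ?uniq_children //=.
by rewrite /padded; lia.
Qed.

Lemma len_leaf v : v < m -> children v = [::] -> len v = 1.
Proof.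
move=> hv E; rewrite lenE // /key /max_key E !big_nil div0n /slack div0n //.
Qed.

Lemma len_gt0 v : v < m -> 0 < len v.
Proof.
move=> hv; case: (eqVneq (children v) [::]) => [E|N]; first by rewrite len_leaf.
have [h [hh _ E _]] := heavy_child (ltnW hv) N.
by rewrite (len_heavy hv hh E).
Qed.

(** * An upper bound on the lengths *)

Section Bound.

(* Passing to a light child halves the length, so at most log2 (len v) paddings
   accumulate at [v]; each costs at most a fraction [1 / Q]. *)
Variables (L Q : nat).
Hypotheses (m_le : m <= 2 ^ L) (Q_def : 2 ^ q = Q.*2) (L_lt : L < Q).

Lemma slack_le x s : x <= s.*2 -> slack x <= s /\ Q * slack x <= s.
Proof.
rewrite /slack Q_def => hx; have := leq_divM x Q.*2; nia.
Qed.

(** The two bounds are proved together: the second one, for the children, limits their slack by the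
    subtree size, and it is recovered at [v] from the first one once the logarithm is known to be at
    most [Q]. *)
Lemma len_bounds v : v < m ->
  Q * len v <= subtree_size v * (Q + trunc_log 2 (len v)) /\
  len v <= (subtree_size v).*2.
Proof.
move: v; apply: bottom_up_ind => v hv IH.
case: (eqVneq (children v) [::]) => [E|N].
  rewrite len_leaf // subtree_size_eq // E big_nil trunc_log1; lia.
have [h [hh _ E hmax]] := heavy_child (ltnW hv) N.
have [IH1 IH2] := IH h hh.
have S : subtree_size v = 1 + subtree_size h +
    \sum_(c <- children v | c != h) subtree_size c.
  by rewrite subtree_size_eq // (bigD1_seq h) ?uniq_children //= addnA.
have lenv := len_heavy hv hh E; have hsz := subtree_size_le v.
set t := trunc_log 2 (len v).
have ht : trunc_log 2 (len h) <= t by apply: leq_trunc_log; lia.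
have sum_le (f g : nat -> nat) :
    (forall c : nat, c \in children v -> c != h -> f c <= g c) ->
    \sum_(c <- children v | c != h) f c <= \sum_(c <- children v | c != h) g c.
  move=> hfg; rewrite big_seq_cond [X in _ <= X]big_seq_cond.
  by apply: leq_sum => c /andP[]; apply: hfg.
have light (c : nat) : c \in children v -> c != h ->
    padded (len c) <= 3 * subtree_size c /\
    Q * padded (len c) <= subtree_size c * (Q + t).
  move=> hc ch; have [h1 h2] := IH c hc; have [h3 h4] := slack_le h2.
  have hcm : c < m by move: hc; rewrite mem_children => /andP[].
  (* The heavy child is at least as long as [c], so [len v] is at least twice [len c]; the logarithm
     gained pays for the slack of [c]. *)
  have tc : (trunc_log 2 (len c)).+1 <= t.
    rewrite -trunc_log2_double ?len_gt0 //; apply: leq_trunc_log.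
    have hf : c \in [seq x <- children v | x != h] by rewrite mem_filter ch hc.
    move: lenv; rewrite -big_filter (bigD1_seq c hf) /=;
      last exact/filter_uniq/uniq_children.
    rewrite {1}/padded; have := hmax c hc; lia.
  rewrite /padded; split; first lia.
  rewrite mulnDr; nia.
have hQ : Q * len v <= subtree_size v * (Q + t).
  have := sum_le _ _ (fun c hc ch => (light c hc ch).2).
  rewrite -big_distrr -big_distrl /= lenv S => hs.
  rewrite mulnDr [X in _ <= X]mulnDl; apply: leq_add hs; nia.
split=> //.
(* A cruder bound suffices to limit the logarithm: [3 * 2 ^ L < 2 ^ L.+2] gives [t <= L.+1 <= Q]. *)
have len3 : len v <= 3 * subtree_size v.
  have := sum_le _ _ (fun c hc ch => (light c hc ch).1).
  by rewrite -big_distrr /= lenv S; lia.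
have tQ : t <= Q.
  have : 2 ^ t < 2 ^ L.+2.
    apply: leq_ltn_trans (trunc_logP _ (len_gt0 hv)) _ => //.
    have := expn_gt0 2 L; rewrite !expnS; lia.
  by rewrite ltn_exp2l // ltnS => /leq_trans->.
have Q_gt0 : 0 < Q by exact: leq_ltn_trans L_lt.
by rewrite -(leq_pmul2l Q_gt0); apply: leq_trans hQ _; nia.
Qed.

Lemma len_le v : v < m -> len v <= m.*2.
Proof.
move=> hv; apply: leq_trans (len_bounds hv).2 _.
by rewrite leq_double subtree_size_le.
Qed.

End Bound.

Lemma slack_le_mono x y : x <= y -> slack x <= slack y.
Proof. exact: leq_div2r. Qed.

(** * Correctness of the interval test *)

Section Intervals.

Variable pos : nat -> nat.

Definition before (u v : nat) : bool := pos u + padded (len u) <= pos v.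

Hypothesis pos_nested : forall v, v < m -> v != rt ->
  pos (par v) < pos v /\ pos v + len v <= pos (par v) + len (par v).
Hypothesis pos_siblings : forall u v, u < m -> v < m -> u != rt -> v != rt ->
  u != v -> par u = par v -> before u v || before v u.

Lemma below_nested u v : u < m -> v < m -> below u v ->
  (u == v) || (pos u < pos v) && (pos v + len v <= pos u + len u).
Proof.
move=> hu; move: v; apply: top_down_ind => [|v hv v_rt IH].
  by rewrite below_root => ->.
rewrite below_par // => /orP[-> //|/IH {}IH]; have [n1 n2] := pos_nested hv v_rt.
apply/orP; right; case/orP: IH => [/eqP->|/andP[h1 h2]]; first by rewrite n1 n2.
by rewrite (ltn_trans h1 n1) (leq_trans n2 h2).
Qed.

Lemma len_par v : v < m -> v != rt -> len v <= len (par v).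
Proof. by move=> hv v_rt; have := pos_nested hv v_rt; lia. Qed.

(** Induction on the sum of the depths, replacing the deeper node by its parent. *)
Lemma below_or_before u v : u < m -> v < m ->
  [|| below u v, below v u, before u v | before v u].
Proof.
have [k] := ubnP (d u + d v); elim: k u v => // k IH u v.
wlog le_d : u v / d u <= d v.
  move=> H hk hu hv; case: (leqP (d u) (d v)) => [|/ltnW] h; first exact: H.
  by have := H v u h; rewrite addnC => /(_ hk hv hu) /or4P[] ->; rewrite ?orbT.
move=> hk hu hv; case: (eqVneq v rt) => [v_rt|v_rt].
  case: (eqVneq u rt) => [->|u_rt]; first by rewrite v_rt below_refl.
  by have := d_par hu u_rt; move: le_d; rewrite v_rt d_rt; lia.
have hpv := par_lt hv v_rt; have dv := d_par hv v_rt.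
have [n1 n2] := pos_nested hv v_rt; have lp := len_par hv v_rt.
have /or4P[h|h|h|h] : [|| below u (par v), below (par v) u, before u (par v)
    | before (par v) u] by apply: IH => //; lia.
- by rewrite below_par // h orbT.
(* Since [u] is not deeper than [v], lying below [par v] makes it [par v] itself or a child of
   [par v]. *)
- case: (eqVneq u v) => [->|uv]; first by rewrite below_refl.
  case: (eqVneq u (par v)) => [->|upv].
    by rewrite below_par // below_refl orbT.
  have u_rt : u != rt.
    by apply: contraNneq upv => E; move: h; rewrite E below_root eq_sym.
  have hp : par v = par u.
    move: h; rewrite below_par // eq_sym (negbTE upv) /=.
    move/(below_depth (par_lt hu u_rt)); have := d_par hu u_rt.
    by case: eqP => // _; lia.
  by have /orP[->|->] := pos_siblings hu hv u_rt v_rt uv (esym hp); rewrite ?orbT.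
- by rewrite /before (leq_trans h) ?orbT // ltnW.
(* The interval of [v] ends no later than that of its parent, and its gap is no wider because
   [slack] is monotone. *)
- have : before v u; last by move=> ->; rewrite !orbT.
  rewrite /before; apply: leq_trans h; have := slack_le_mono lp.
  by rewrite /padded; lia.
Qed.

(** Truncated subtraction gives short intervals the exponent 0, which stores them exactly. As
    [mantissa] divides the last offset [(len v).-1], the length [(mantissa v).+1 * 2 ^ exponent v]
    is [len v] rounded up. *)
Definition exponent (v : nat) : nat := trunc_log 2 (len v) - q.
Definition mantissa (v : nat) : nat := (len v).-1 %/ 2 ^ exponent v.

(** Rounding up overshoots by less than [2 ^ exponent v], hence stays inside the gap. *)
Lemma exponent_slack v : v < m -> 0 < exponent v ->
  2 ^ exponent v <= slack (len v).
Proof.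
rewrite /exponent subn_gt0 => hv h.
rewrite leq_divRL ?expn_gt0 // -expnD subnK ?(ltnW h) //.
exact/trunc_logP/len_gt0.
Qed.

Lemma mantissa_lt v : mantissa v < 2 ^ q.+1.
Proof.
rewrite ltn_divLR ?expn_gt0 // -expnD.
apply: leq_ltn_trans (leq_pred _) _.
apply: leq_trans (trunc_log_ltn (len v) (isT : 1 < 2)) _.
by rewrite leq_exp2l // /exponent; lia.
Qed.

Lemma interval_test u v : u < m -> v < m ->
  (pos u < pos v) && ((pos v - pos u) %/ 2 ^ exponent u <= mantissa u) =
  (u != v) && below u v.
Proof.
move=> hu hv; case: (eqVneq u v) => [->|uv]; first by rewrite ltnn.
have gt0 w : w < m -> 0 < len w by exact: len_gt0.
have := gt0 u hu; have := gt0 v hv => lv lu.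
have /or4P[h|h|h|h] := below_or_before hu hv.
- have := below_nested hu hv h; rewrite (negbTE uv) h /= => /andP[-> h2] /=.
  by rewrite /mantissa leq_div2r //; lia.
- have := below_nested hv hu h; rewrite eq_sym (negbTE uv) /= => /andP[h1 h2].
  rewrite ltnNge (ltnW h1) /=; case: (boolP (below u v)) => // h3.
  by have := below_nested hu hv h3; rewrite (negbTE uv); lia.
- have nb : below u v = false.
    apply/negP => h3; have := below_nested hu hv h3; rewrite (negbTE uv) /=.
    by move: h; rewrite /before /padded; lia.
  rewrite nb; apply/negbTE; rewrite negb_and -ltnNge; apply/orP; right.
  have e2 := exponent_slack hu.
  have : (len u).-1 + 2 ^ exponent u <= pos v - pos u.
    (* With exponent 0 the gap may be empty, but then the rounding is exact and the end of the
       interval alone suffices. *)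
    move: h e2; rewrite /before /padded; case: (exponent u) => [|e] h.
      by move=> _; rewrite expn0; lia.
    by move=> /(_ isT); lia.
  move=> /(leq_div2r (2 ^ exponent u)); rewrite divnDr ?dvdnn // divnn expn_gt0 /=.
  by rewrite addn1 -ltnNge.
- have nb : below u v = false.
    apply/negP => h3; have := below_nested hu hv h3; rewrite (negbTE uv) /=.
    by move: h; rewrite /before /padded; lia.
  rewrite nb ltnNge (_ : pos v <= pos u) //.
  by move: h; rewrite /before /padded; lia.
Qed.

End Intervals.

(** * Placing the intervals from the root down *)

Section Placement.

Lemma key_dummy : key m = len rt * B + rt.
Proof. by rewrite /key children_dummy /max_key big_seq1. Qed.

Lemma heavy_root : heavy rt.
Proof. by rewrite /heavy par_rt key_dummy. Qed.

Definition light_sum (D : seq nat) (u : nat) : nat :=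
  \sum_(c <- children u | (c \in D) && ~~ heavy c) padded (len c).

Lemma light_sum_cons D v u : v < m -> v \notin D ->
  light_sum (v :: D) u =
  light_sum D u + (if (par v == u) && ~~ heavy v then padded (len v) else 0).
Proof.
move=> hv vD; rewrite /light_sum.
case: (boolP (heavy v)) => hvy; rewrite ?andbF ?andbT /=.
  rewrite addn0; apply: eq_bigl => c; rewrite inE.
  by case: eqP => // ->; rewrite hvy /= andbF.
rewrite (@big_add1_seq _ _ addn _ _ (fun c => (c \in D) && ~~ heavy c) _ v)
  ?uniq_children //.
- by rewrite mem_children hv.
- by move=> c; rewrite inE; case: eqP => // ->; rewrite hvy.
- by rewrite (negbTE vD).
Qed.

(** Whichever light children have been placed, the space at the right end of [p] stays free for the
    heavy child, since [len p] counts all light children. *)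
Lemma light_sum_bound D p h : p < m -> h \in children p -> heavy h ->
  light_sum D p + len h < len p.
Proof.
move=> hp hh hvy.
have N : children p != [::] by apply: contraTneq hh => ->.
have [h' [hh' K' E' _]] := heavy_child (ltnW hp) N.
have E : h = h' by apply/eqP; rewrite -(heavyP K' hh' hh).
rewrite -{}E in hh' K' E'.
rewrite (len_heavy hp hh E') addnC -addnA add1n ltnS leq_add2l.
rewrite /light_sum big_mkcond [X in _ <= X]big_mkcond /=.
rewrite big_seq [X in _ <= X]big_seq; apply: leq_sum => c hc.
rewrite (heavyP K' hh' hc).
by case: (c == h) => //=; rewrite ?andbF ?andbT //; case: ifP.
Qed.

Lemma light_has_heavy v : v < m -> ~~ heavy v ->
  exists2 h, h \in children (par v) & heavy h.
Proof.
move=> hv hl.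
have v_rt : v != rt by apply: contraNneq hl => ->; exact: heavy_root.
have hc : v \in children (par v) by rewrite mem_children hv /=.
have N : children (par v) != [::] by apply: contraTneq hc => ->.
have [h [hh K' _ _]] := heavy_child (ltnW (par_lt hv v_rt)) N.
by exists h; rewrite // (heavyP K' hh hh).
Qed.

(** [D] is the set of nodes placed so far and is closed under parents. Heavy children are aligned at
    the right end; light ones fill up from the left, and [next] bounds all of them, so a new one
    starts behind its light siblings. *)
Record placed (D : seq nat) (pos next : nat -> nat) : Prop := Placed {
  placed_next : forall v, v \in D -> next v = (pos v).+1 + light_sum D v;
  placed_par : forall v, v \in D -> v != rt -> par v \in D;
  placed_heavy : forall v, v \in D -> v != rt -> heavy v ->
    pos v + len v = pos (par v) + len (par v);
  placed_light : forall v, v \in D -> ~~ heavy v ->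
    pos (par v) < pos v /\ pos v + padded (len v) <= next (par v);
  placed_siblings : forall u v, u \in D -> v \in D -> ~~ heavy u -> ~~ heavy v ->
    u != v -> par u = par v -> before pos u v || before pos v u;
  placed_root : rt \in D -> pos rt = 0
}.

Lemma placed_nil pos next : placed [::] pos next.
Proof. by split. Qed.

Lemma placed_cons D pos next v : {subset D <= gtn m} -> placed D pos next ->
  v < m -> v \notin D -> (v != rt -> par v \in D) ->
  let a := if v == rt then 0 else
           if heavy v then pos (par v) + len (par v) - len v else next (par v) in
  let next' := if heavy v then next
               else upd next (par v) (next (par v) + padded (len v)) in
  placed (v :: D) (upd pos v a) (upd next' v a.+1).
Proof.
move=> Dm [H1 H2 H3 H4 H5 H6] hv vD hp a next'.
have neq u : u \in D -> (u == v) = false by move=> hu; apply: contraNF vD => /eqP <-.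
have par_neq u : u \in D -> u != rt -> (par u == v) = false.
  by move=> hu u_rt; apply/neq/H2.
have light_rt u : ~~ heavy u -> u != rt by apply: contraNneq => ->; exact: heavy_root.
have pv_neq : v != rt -> (par v == v) = false by move=> /hp/neq.
have v_no_child u : u \in D -> (par u == v) = false.
  move=> hu; case: (eqVneq u rt) => [->|]; last exact: par_neq.
  by rewrite par_rt; apply/eqP => E; move: hv; rewrite -E ltnn.
(* Parents are placed before their children, so no child of [v] is placed yet. *)
have sum0 : light_sum (v :: D) v = 0.
  rewrite /light_sum big1_seq // => c /andP[/andP[]]; rewrite inE mem_children.
  case/predU1P=> [->|cD] hl /andP[_ hc]; last by rewrite v_no_child in hc.
  by rewrite (pv_neq (light_rt _ hl)) in hc.
split.
- move=> u; rewrite inE; case: eqP => [-> _|_ /= hu].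
    by rewrite sum0 /upd eqxx addn0.
  rewrite light_sum_cons // /upd (neq u hu) /next'.
  case: (boolP (heavy v)) => hvy /=; rewrite ?andbF ?addn0 ?H1 //.
  rewrite /upd andbT [u == par v]eq_sym; case: eqP => [->|_]; rewrite ?H1 ?addn0 //.
    by rewrite addnA.
  exact/hp/light_rt.
- move=> u; rewrite !inE; case/predU1P=> [->|hu] u_rt; first by rewrite hp ?orbT.
  by rewrite H2 ?orbT.
- move=> u; rewrite inE; case/predU1P=> [->|hu] u_rt hvy.
    rewrite /upd eqxx pv_neq // /a (negbTE u_rt) hvy subnK //.
    have pm : par v < m by exact: par_lt.
    have hc : v \in children (par v) by rewrite mem_children hv /=.
    by have := light_sum_bound [::] pm hc hvy; lia.
  by rewrite /upd (neq u hu) par_neq // H3.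
- move=> u; rewrite inE; case/predU1P=> [->|hu] hl.
    have v_rt := light_rt _ hl; rewrite /upd eqxx pv_neq // /a (negbTE v_rt).
    rewrite /next' (negbTE hl) /upd eqxx H1 ?hp //; lia.
  have u_rt := light_rt _ hl; rewrite /upd (neq u hu) par_neq //.
  have [h1 h2] := H4 u hu hl; split=> //.
  rewrite /next'; case: (heavy v) => //; rewrite /upd; case: eqP => // <-; lia.
- have key_case u : u \in D -> ~~ heavy u -> ~~ heavy v -> par u = par v ->
      pos u + padded (len u) <= a.
    move=> hu hu' hl E; have v_rt := light_rt _ hl.
    rewrite /a (negbTE v_rt) (negbTE hl) -E; exact: (H4 u hu hu').2.
  move=> u w; rewrite !inE /before /upd.
  case/predU1P=> [->|hu]; case/predU1P=> [->|hw] lu lw uw E.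
  + by rewrite eqxx in uw.
  + by rewrite eqxx (neq w hw) (key_case w) ?orbT.
  + by rewrite eqxx (neq u hu) (key_case u).
  + by rewrite (neq u hu) (neq w hw); exact: H5.
- by rewrite inE /upd /a; case: eqP => [->|_ /= /H6] //; rewrite eqxx.
Qed.

(** A heavy child ends together with its parent; a light one ends by [next (par v)], which does not
    exceed the start reserved for the heavy child. *)
Lemma placed_nested D pos next : {subset D <= gtn m} -> placed D pos next ->
  forall v, v \in D -> v != rt ->
  pos (par v) < pos v /\ pos v + len v <= pos (par v) + len (par v).
Proof.
move=> Dm [H1 H2 H3 H4 _ _] v hv v_rt; have vm : v < m := Dm v hv.
have pm := par_lt vm v_rt; case: (boolP (heavy v)) => hvy.
  have := H3 v hv v_rt hvy.
  have hc : v \in children (par v) by rewrite mem_children vm /=.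
  by have := light_sum_bound [::] pm hc hvy; lia.
have [h1 h2] := H4 v hv hvy; split=> //; have [h hh hhvy] := light_has_heavy vm hvy.
have := light_sum_bound D pm hh hhvy.
by move: h2; rewrite H1 ?H2 // /padded; lia.
Qed.

Lemma placed_le_root D pos next : {subset D <= gtn m} -> placed D pos next ->
  forall v, v \in D -> pos v + len v <= len rt.
Proof.
move=> Dm H v vD; have := vD; have : v < m := Dm v vD; move: v {vD}.
apply: top_down_ind => [hr|v hv v_rt IH vD]; first by rewrite (placed_root H hr).
have [_ h] := placed_nested Dm H vD v_rt.
exact: leq_trans h (IH (placed_par H vD v_rt)).
Qed.

Lemma placed_next_le D pos next : {subset D <= gtn m} -> placed D pos next ->
  forall p, p \in D -> next p <= pos p + len p.
Proof.
move=> Dm H p pD; have pm : p < m := Dm p pD; rewrite (placed_next H pD).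
case: (eqVneq (children p) [::]) => [E|N].
  by rewrite /light_sum E big_nil addn0 -addn1 leq_add2l len_gt0.
have [h [hh K' _ _]] := heavy_child (ltnW pm) N.
have hvy : heavy h by rewrite (heavyP K' hh hh).
by have := light_sum_bound D pm hh hvy; lia.
Qed.

(** Two siblings cannot both be heavy, and a heavy child starts no earlier than [next] of its
    parent, behind the gaps of its light siblings. *)
Lemma placed_before D pos next : {subset D <= gtn m} -> placed D pos next ->
  forall u v, u \in D -> v \in D -> u != rt -> v != rt ->
  u != v -> par u = par v -> before pos u v || before pos v u.
Proof.
move=> Dm H; have hl u v : u \in D -> v \in D -> u != rt -> v != rt -> u != v ->
    par u = par v -> ~~ heavy u -> heavy v -> before pos u v.
  move=> hu hv u_rt v_rt uv E lu hvy.
  have pm := par_lt (Dm v hv) v_rt.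
  have hc : v \in children (par v) by rewrite mem_children (Dm v hv : v < m) /=.
  have := light_sum_bound D pm hc hvy; have [_] := placed_light H hu lu.
  rewrite E (placed_next H (placed_par H hv v_rt)) /before.
  have := placed_heavy H hv v_rt hvy; lia.
move=> u v hu hv u_rt v_rt uv E.
case: (boolP (heavy u)) => lu; case: (boolP (heavy v)) => lv.
- have pm := par_lt (Dm v hv) v_rt.
  have hcv : v \in children (par v) by rewrite mem_children (Dm v hv : v < m) /=.
  have hcu : u \in children (par v) by rewrite mem_children (Dm u hu : u < m) E /=.
  have N : children (par v) != [::] by apply: contraTneq hcv => ->.
  have [h [hh K' _ _]] := heavy_child (ltnW pm) N.
  move: lu lv uv; rewrite (heavyP K' hh hcu) (heavyP K' hh hcv).
  by move=> /eqP -> /eqP ->; rewrite eqxx.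
- by rewrite (hl v u) ?orbT // eq_sym.
- by rewrite (hl u v).
- exact: placed_siblings H _ _ _ _ _ _ _ _.
Qed.

End Placement.

End Tree.

(** * The marker *)

(* Arrays: 0 parents, later labels; 1 number of children not yet handled;
   2 binary logarithms; 3 queue; 4 sum of the padded lengths of the handled
   children; 5 keys; 6 lengths; 7 end of the interval; 8 next free position.
   Cells [m] belong to the dummy parent of the root, whose count of children
   starts at 1 so that it is never put in the queue. *)

Definition marker_init : seq ainstr := [:: AConst 2 1; AStore 1 0 2].

(** Without a branch, the parent [p] of node [k] becomes [p + (p == k) * (m - p)], which redirects
    the root to the dummy. The logarithm of [k.+1] yields those of [k.+1.*2] and [k.+1.*2.+1]. *)
Definition marker_count : seq ainstr := [::
  ALoad 2 0 1; AOp OEq 3 2 1; AOp OSub 4 0 2; AOp OMul 3 3 4; AOp OAdd 2 2 3;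
  AStore 0 1 2;
  ALoad 3 1 2; AConst 4 1; AOp OAdd 3 3 4; AStore 1 2 3;
  AOp OAdd 1 1 4;
  ALoad 3 2 1; AOp OAdd 3 3 4; AOp OAdd 2 1 1; AStore 2 2 3;
  AOp OAdd 2 2 4; AStore 2 2 3].

(** Every node is written behind the end of the queue, but register 5, the length of the queue,
    grows only if the node is a leaf. *)
Definition marker_leaves : seq ainstr := [::
  AStore 3 5 1; ALoad 2 1 1; AConst 3 0; AOp OEq 2 2 3; AOp OAdd 5 5 2;
  AConst 3 1; AOp OAdd 1 1 3].

(** Handles the next node of the queue and updates its parent. The maximum of two keys is formed by
    a truncated subtraction and an addition; the parent joins the queue when its count reaches 0. *)
Definition marker_lengths (B q : nat) : seq ainstr := [::
  ALoad 2 3 1;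
  ALoad 3 5 2; AConst 4 B; AOp ODiv 3 3 4; AConst 6 (2 ^ q); AOp ODiv 3 3 6;
  ALoad 7 4 2; AConst 8 1; AOp OAdd 7 7 8; AOp OSub 7 7 3; AStore 6 2 7;
  AOp ODiv 3 7 6; AOp OAdd 3 7 3;
  ALoad 9 0 2;
  ALoad 10 4 9; AOp OAdd 10 10 3; AStore 4 9 10;
  AOp OMul 10 7 4; AOp OAdd 10 10 2;
  ALoad 11 5 9; AOp OSub 10 10 11; AOp OAdd 10 11 10; AStore 5 9 10;
  ALoad 10 1 9; AOp OSub 10 10 8; AStore 1 9 10;
  AStore 3 5 9; AConst 11 0; AOp OEq 10 10 11; AOp OAdd 5 5 10;
  AOp OAdd 1 1 8].

Definition marker_root (B : nat) : seq ainstr := [::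
  ALoad 2 5 0; AConst 3 B; AOp ODiv 2 2 3; AStore 7 0 2; AConst 1 0].

(** The queue is read from its end. Multiplication by the test for heaviness or its complement
    selects the position, and adding [2 ^ b] supplies the leading 1 of the code. *)
Definition marker_labels (B q K b : nat) : seq ainstr := [::
  AConst 8 1; AOp OSub 2 0 8; AOp OSub 2 2 1; ALoad 2 3 2;
  ALoad 3 0 2; ALoad 4 6 2;
  ALoad 5 5 3; AConst 6 B; AOp OMul 7 4 6; AOp OAdd 7 7 2; AOp OEq 5 5 7;
  ALoad 7 7 3; AOp OSub 7 7 4; ALoad 9 8 3; AOp OSub 10 8 5;
  AOp OMul 7 7 5; AOp OMul 11 9 10; AOp OAdd 7 7 11;
  AConst 6 (2 ^ q); AOp ODiv 11 4 6; AOp OAdd 11 4 11; AOp OMul 11 11 10;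
  AOp OAdd 9 9 11; AStore 8 3 9;
  AOp OAdd 9 7 4; AStore 7 2 9; AOp OAdd 9 7 8; AStore 8 2 9;
  ALoad 9 2 4; AConst 10 q; AOp OSub 9 9 10; AOp OSub 10 4 8; AOp OShr 10 10 9;
  AConst 11 K; AOp OMul 7 7 11; AOp OAdd 7 7 9; AOp OMul 7 7 11; AOp OAdd 7 7 10;
  AConst 11 (2 ^ b); AOp OAdd 7 11 7; AStore 0 2 7;
  AOp OAdd 1 1 8].

Definition marker (B q K b : nat) : seq stmt := [::
  Block marker_init; For marker_count;
  Block [:: AConst 1 0; AConst 5 0]; For marker_leaves;
  Block [:: AConst 1 0]; For (marker_lengths B q);
  Block (marker_root B); For (marker_labels B q K b)].

Section Marker.

Variables (m rt : nat) (par par0 d : nat -> nat).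
Hypothesis tree : rooted m rt par d.
Hypothesis par0_lt : forall v, v < m -> par0 v < m.
Hypothesis parE : forall v, v < m -> par v = if par0 v == v then m else par0 v.

Variables (B q K b W : nat).
Hypotheses (m_B : 4 * m < B) (B_gt : 16 <= B) (B_W : B * B <= 2 ^ W).
Hypothesis q_W : 2 ^ q < 2 ^ W.
Hypotheses (K_W : m.*2 * (K * K) <= 2 ^ b) (b_W : (2 ^ b).*2 <= 2 ^ W).
Hypotheses (K_log : forall x, x <= m.*2 -> trunc_log 2 x < K) (K_q : 2 ^ q.+1 <= K).
Hypothesis len_le_m : forall v, v < m -> len m par d B q v <= m.*2.

Notation children := (children m par).
Notation len := (len m par d B q).
Notation key := (key m par d B q).
Notation heavy := (heavy m par d B q).
Notation padded := (padded q).
Notation wp := (wp B W).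
Notation wps := (wps B W m).

Lemma B_small : 16 * B <= 2 ^ W.
Proof. by apply: leq_trans B_W; rewrite leq_mul2r B_gt orbT. Qed.

Lemma par_le v : v < m -> par v <= m.
Proof. by move=> hv; rewrite parE //; case: ifP => // _; apply/ltnW/par0_lt. Qed.

Lemma iota_rcons k : iota 0 k.+1 = rcons (iota 0 k) k.
Proof. by rewrite -addn1 iotaD cats1. Qed.

Lemma upd2E F j a x j' a' :
  upd2 F j a x j' a' = if (j' == j) && (a' == a) then x else F j' a'.
Proof. by []. Qed.

Definition log_table (k : nat) (F : nat -> nat -> nat) : Prop :=
  forall x, 0 < x < k -> F 2 x = trunc_log 2 x.

(** The table of logarithms reaches far enough for the next round to read entry [k.+1], and after
    all rounds it covers the lengths up to [m.*2]. *)
Definition count_inv (k : nat) (R : nat -> nat) (F : nat -> nat -> nat) : Prop :=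
  (R 0 = m /\ R 1 = k) /\
  [/\ forall v, v < m -> F 0 v = if v < k then par v else par0 v,
      forall u, u <= m -> F 1 u = (u == m) + count (fun c => par c == u) (iota 0 k),
      log_table k.+1.*2 F
    & forall j v, 3 <= j < 9 -> v < B -> F j v = 0].

Lemma count_rule : for_rule B W m marker_count count_inv.
Proof.
split=> [k R F [] //|k R F hk [[R0 R1] [H0 H1 H2 H3]]].
have bs := B_small; have Bs : m < B by lia.
xload k (par0 k); first by rewrite H0 // ltnn.
have p_lt := par0_lt hk; have p_le := par_le hk.
xop (par0 k == k : nat); first by [].
xop (m - par0 k); first by [].
xop ((par0 k == k) * (m - par0 k)); first by [].
xop (par k).
  by rewrite parE //; case: eqP; lia.
xstore k (par k).
xload (par k) (F 1 (par k)); first by [].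
have Fp : F 1 (par k) <= m.+1.
  rewrite H1 //; have := count_size (fun c => par c == par k) (iota 0 k).
  by rewrite size_iota; case: (_ == _) => /=; lia.
xconst.
xop (F 1 (par k)).+1; first by rewrite addn1.
xstore (par k) (F 1 (par k)).+1.
xop k.+1; first by rewrite addn1.
xload k.+1 (trunc_log 2 k.+1); first by rewrite !upd2E /= H2 //; lia.
have lg : trunc_log 2 k.+1 < m.+1.
  rewrite ltnS -(leq_exp2l (m := 2)) //; apply: leq_trans (trunc_logP _ _) _ => //.
  by apply: leq_trans hk _; exact/ltnW/ltn_expl.
xop (trunc_log 2 k.+1).+1; first by rewrite addn1.
xop k.+1.*2; first by rewrite addnn.
xstore k.+1.*2 (trunc_log 2 k.+1).+1.
xop k.+1.*2.+1; first by rewrite addn1.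
xstore k.+1.*2.+1 (trunc_log 2 k.+1).+1.
split; first by split; read_regs.
split.
- move=> v hv; rewrite !upd2E /= ltnS; case: (eqVneq v k) => [->|vk].
    by rewrite leqnn.
  by rewrite H0 // [v <= k]leq_eqVlt (negbTE vk).
- move=> u hu; rewrite iota_rcons -cats1 count_cat !upd2E /= addn0 !H1 //.
  rewrite [par k == u]eq_sym; case: eqP => [->|_]; lia.
- move=> x hx; rewrite !upd2E /=.
  case: eqP => [->|N1]; first by rewrite (@trunc_log2S k.+1.*2.+1) //= uphalf_double.
  case: eqP => [->|N2]; first by rewrite trunc_log2_double.
  by rewrite H2 //; lia.
- by move=> j v hj hv; rewrite !upd2E; case: j hj => [|[|[|j]]] //= hj; rewrite H3.
Qed.

Definition leaves (k : nat) : seq nat := [seq u <- iota 0 k | children u == [::]].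

Definition leaves_inv (k : nat) (R : nat -> nat) (F : nat -> nat -> nat) : Prop :=
  (R 0 = m /\ R 1 = k) /\
  [/\ R 5 = size (leaves k),
      forall i, i < size (leaves k) -> F 3 i = nth 0 (leaves k) i
    & [/\ forall v, v < m -> F 0 v = par v,
        forall u, u <= m -> F 1 u = (u == m) + size (children u),
        log_table m.+1.*2 F
      & forall j v, 4 <= j < 9 -> v < B -> F j v = 0]].

Lemma leaves_rule : for_rule B W m marker_leaves leaves_inv.
Proof.
split=> [k R F [] //|k R F hk [[R0 R1] [R5 HQ [H0 H1 H2 H3]]]].
have bs := B_small; have Bs : m < B by lia.
have sz : size (leaves k) <= k by rewrite size_filter -{2}(size_iota 0 k) count_size.
xstore (size (leaves k)) k.
xload k (size (children k)).
  by rewrite upd2E /= H1 ?(ltnW hk) // (ltn_eqF hk).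
xconst.
xop (children k == [::] : nat); first by rewrite -size_eq0.
have hs : size (leaves k.+1) = size (leaves k) + (children k == [::]).
  rewrite /leaves iota_rcons filter_rcons; case: ifP => _; rewrite ?addn0 //.
  by rewrite size_rcons addn1.
xop (size (leaves k.+1)); first by rewrite hs.
xconst.
xop k.+1; first by rewrite addn1.
split; first by split; read_regs.
split; first by read_regs.
  move=> i hi; rewrite upd2E /=.
  have E : nth 0 (rcons (leaves k) k) i = nth 0 (leaves k.+1) i.
    move: hi; rewrite /leaves iota_rcons filter_rcons; case: ifP => // _ hi.
    by rewrite nth_rcons hi.
  rewrite -E nth_rcons; case: eqP => [->|N]; first by rewrite ltnn.
  case: ltnP => hi'; first exact: HQ.
  by move: hi; rewrite hs; lia.
split=> [v hv|u hu|x hx|j v hj hv]; rewrite upd2E ?H0 ?H1 ?H2 //.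
by case: j hj => [|[|[|[|j]]]] //= hj; rewrite H3.
Qed.

(** [s] is the content of the queue and [take h s] the handled part. [ls_order] is kept for the last
    loop, where reversing the queue has to put parents before children. *)
Record lengths_state (h : nat) (s : seq nat) (F : nat -> nat -> nat) : Prop := {
  ls_uniq : uniq s;
  ls_le : h <= size s;
  ls_lt : forall u, u \in s -> u < m;
  ls_mem : forall u, u < m -> (u \in s) = all (mem (take h s)) (children u);
  ls_order : forall i, i < h -> {subset children (nth 0 s i) <= take i s};
  ls_par : forall v, v < m -> F 0 v = par v;
  ls_count : forall u, u <= m ->
    F 1 u + count (mem (take h s)) (children u) = (u == m) + size (children u);
  ls_log : log_table m.+1.*2 F;
  ls_queue : forall i, i < size s -> F 3 i = nth 0 s i;
  ls_sum : forall u, u <= m ->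
    F 4 u = \sum_(c <- children u | c \in take h s) padded (len c);
  ls_key : forall u, u <= m ->
    F 5 u = \max_(c <- children u | c \in take h s) (len c * B + c);
  ls_len : forall u, u \in take h s -> F 6 u = len u;
  ls_next : F 8 m = 0
}.

Definition lengths_inv (h : nat) (R : nat -> nat) (F : nat -> nat -> nat) : Prop :=
  (R 0 = m /\ R 1 = h) /\ exists2 s, R 5 = size s & lengths_state h s F.

(** If all queued nodes were handled, bottom-up induction would put every node into the queue,
    contradicting [h < m]. *)
Lemma queue_progress h s F : lengths_state h s F -> h < m -> h < size s.
Proof.
move=> H hm; rewrite ltn_neqAle (ls_le H) andbT; apply/eqP => E.
have sub : {subset iota 0 m <= s}.
  move=> u; rewrite mem_iota add0n => /= hu; move: u hu.
  apply: (bottom_up_ind tree) => u hu IH.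
  rewrite (ls_mem H hu); apply/allP => c /IH; by rewrite /= E take_size.
have := uniq_leq_size (iota_uniq 0 m) sub.
by rewrite size_iota -E leqNgt hm.
Qed.

Lemma queue_size h s F : lengths_state h s F -> size s <= m.
Proof.
move=> H; rewrite -(size_iota 0 m); apply: uniq_leq_size (ls_uniq H) _ => u hu.
by rewrite mem_iota /= add0n (ls_lt H).
Qed.

Lemma slack_id x : slack q x <= x.
Proof. exact: leq_div. Qed.

(** Excludes overflow. The stored sum pads the heavy child too, so it can exceed [len u], by at most
    the slack of that child. *)
Lemma children_sum_le u : u <= m -> \sum_(c <- children u) padded (len c) <= 4 * m.
Proof.
have Bs : m < B by lia.
rewrite leq_eqVlt => /predU1P[->|hu].
  rewrite (children_dummy tree) big_seq1 /padded; have := slack_id (len rt).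
  have := len_le_m (rooted_lt tree); lia.
case: (eqVneq (children u) [::]) => [->|N]; first by rewrite big_nil.
have [h [hh _ E _]] := heavy_child d q Bs (ltnW hu) N.
have := lenE tree q Bs hu; rewrite E.
have hm : h < m by move: hh; rewrite mem_children => /andP[].
have := slack_id (len h); have := len_le_m hm; have := len_le_m hu; lia.
Qed.

Lemma len_key_lt c : c < m -> len c * B + c < B * B.
Proof. by move=> hc; have := len_le_m hc; nia. Qed.

Lemma children_key_lt u (P : pred nat) :
  \max_(c <- children u | P c) (len c * B + c) < B * B.
Proof.
have B2 : 0 < B * B by nia.
rewrite -(prednK B2) ltnS; apply/bigmax_leqP_seq => c; rewrite mem_children.
by move=> /andP[/len_key_lt hc _] _; rewrite -ltnS prednK.
Qed.

Lemma lengths_rule : for_rule B W m (marker_lengths B q) lengths_inv.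
Proof.
split=> [h R F [] //|h R F hm [[R0 R1] [s R5 H]]].
have hs := queue_progress H hm; have sm := queue_size H.
have bs := B_small; have Bs : m < B by lia.
set v := nth 0 s h; set D := take h s.
have vs : v \in s by exact: mem_nth.
have vm : v < m := ls_lt H vs.
have chD : all (mem D) (children v) by rewrite -(ls_mem H vm).
set p := par v; have pm : p <= m := par_le vm.
have vD : v \notin D.
  by have := ls_uniq H; rewrite -(cat_take_drop h s) (drop_nth 0 hs) cat_uniq /=
    => /and3P[_ /norP[]].
have takeS : take h.+1 s = rcons D v by rewrite (take_nth 0).
(* All children of [v] are handled, so the partial sum and the partial maximum are already
   complete. *)
have sumv : F 4 v = \sum_(c <- children v) padded (len c).
  rewrite (ls_sum H) ?(ltnW vm) // big_seq_cond [RHS]big_seq_cond.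
  by apply: eq_bigl => c; rewrite andbT andb_idr // => /(allP chD).
have keyv : F 5 v = key v.
  rewrite (ls_key H) ?(ltnW vm) // big_seq_cond /key /max_key [RHS]big_seq_cond.
  by apply: eq_bigl => c; rewrite andbT andb_idr // => /(allP chD).
have lenv := lenE tree q Bs vm.
have lev := len_le_m vm; have slv := slack_id (len v).
have keyB : key v < B * B by exact: children_key_lt.
have vp : v \in children p by rewrite mem_children vm /=.
have notin u : u != p -> v \notin children u.
  by rewrite mem_children vm /= eq_sym.
pose D' := rcons D v.
have D'E c : (c \in D') = (c == v) || (c \in D) by rewrite mem_rcons inE.
have sumD u : \sum_(c <- children u | c \in D') padded (len c) =
    \sum_(c <- children u | c \in D) padded (len c) +
    (if v \in children u then padded (len v) else 0).
  exact: (@big_add1_seq _ _ addn _ _ (mem D)) (uniq_children _ _ _) D'E vD.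
have keyD u : \max_(c <- children u | c \in D') (len c * B + c) =
    maxn (\max_(c <- children u | c \in D) (len c * B + c))
    (if v \in children u then len v * B + v else 0).
  exact: (@big_add1_seq _ _ maxn _ _ (mem D)) (uniq_children _ _ _) D'E vD.
have countD u : count (mem D') (children u) =
    count (mem D) (children u) + (v \in children u).
  rewrite -!sum1_count.
  rewrite (@big_add1_seq _ _ addn _ _ (mem D) _ v _ (uniq_children _ _ _) D'E vD) /=.
  by case: (_ \in _).
have sumbound : \sum_(c <- children p | c \in D') padded (len c) <= 4 * m.
  apply: leq_trans (children_sum_le pm); rewrite big_mkcond; apply: leq_sum => c _.
  by case: ifP.
have sump := ls_sum H pm; have keyp := ls_key H pm; have cntp := ls_count H pm.
rewrite -/D in sump keyp cntp.
have cnt_le := count_size (mem D') (children p).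
have sumD' := sumD p; have keyD' := keyD p; have countD' := countD p.
rewrite vp in sumD' keyD' countD'.
have keyp_lt := children_key_lt p (mem D).
have keyp_lt' := children_key_lt p (mem D').
have newkey_lt := len_key_lt vm.
have F1p : F 1 p <= m.+1.
  have : size (children p) <= m by rewrite size_filter -{2}(size_iota 0 m) count_size.
  by move: cntp; case: (p == m) => /=; lia.
xload h v; first by rewrite (ls_queue H).
xload v (key v); first by [].
xconst.
xop (key v %/ B); first by [].
  by apply: leq_ltn_trans (leq_div _ _) _; lia.
xconst.
xop (slack q (key v %/ B)); first by [].
  by apply: leq_ltn_trans (slack_id _) _; apply: leq_ltn_trans (leq_div _ _) _; lia.
have sumv_le := children_sum_le (ltnW vm).
xload v (F 4 v); first by [].
xconst.
xop (F 4 v).+1; first by rewrite addn1.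
xop (len v); first by rewrite lenv sumv.
xstore v (len v).
xop (slack q (len v)); first by [].
xop (padded (len v)); first by [].
xload v p; first by rewrite upd2E /= (ls_par H).
xload p (F 4 p); first by [].
xop (F 4 p + padded (len v)); first by [].
xstore p (F 4 p + padded (len v)).
xop (len v * B); first by [].
xop (len v * B + v); first by [].
xload p (F 5 p); first by [].
xop (len v * B + v - F 5 p); first by [].
xop (maxn (F 5 p) (len v * B + v)); first by rewrite maxnE.
  by rewrite keyp -keyD'; apply: leq_trans keyp_lt' B_W.
xstore p (maxn (F 5 p) (len v * B + v)).
xload p (F 1 p); first by [].
xop (F 1 p - 1); first by [].
xstore p (F 1 p - 1).
xstore (size s) p.
xconst.
set z := F 1 p - 1 == 0.
xop (z : nat); first by [].
pose s' := if z then rcons s p else s.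
xop (size s'); first by rewrite /s'; case: (z); rewrite ?size_rcons ?addn1 ?addn0.
  by rewrite /s'; case: (z); rewrite ?size_rcons; lia.
xop h.+1; first by rewrite addn1.
split; first by split; read_regs.
exists s'; first by read_regs.
have take' i : i <= size s -> take i s' = take i s.
  by rewrite /s' => hi; case: (z); rewrite // -cats1 takel_cat.
have nth' i : i < size s -> nth 0 s' i = nth 0 s i.
  by rewrite /s' => hi; case: (z); rewrite // nth_rcons hi.
have D'take : take h.+1 s' = D' by rewrite take' // takeS.
(* The parent cannot be queued yet, because its child [v] was not handled before. *)
have ps : p \notin s.
  apply/negP => hp; have hpm := ls_lt H hp; move: hp; rewrite (ls_mem H hpm).
  by move/allP/(_ v vp); rewrite /= (negbTE vD).
(* The count of the dummy started one higher, so it never drops to 0 here. *)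
have zE : z = (p < m) && all (mem D') (children p).
  rewrite all_count [p < m]ltn_neqAle pm andbT /z.
  by move: cntp countD' cnt_le; rewrite -/D; case: (p == m) => /=; lia.
have mems' u : (u \in s') = (z && (u == p)) || (u \in s).
  by rewrite /s'; case: (z); rewrite ?mem_rcons ?inE.
split.
- by rewrite /s'; case: (z); rewrite ?rcons_uniq ?ps (ls_uniq H).
- by rewrite /s'; case: (z); rewrite ?size_rcons; lia.
- by move=> u; rewrite mems' zE => /orP[/andP[/andP[+ _] /eqP ->]|/(ls_lt H)].
- move=> u hu; rewrite mems' D'take; case: (eqVneq u p) => [E|up].
    by rewrite andbT zE -E hu E (negbTE ps) orbF.
  rewrite andbF /= (ls_mem H hu); apply: eq_in_all => c hc /=; rewrite -/D D'E.
  by case: eqP => // E; have := notin u up; rewrite -E hc.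
- move=> i; rewrite ltnS leq_eqVlt => /predU1P[->|hi].
    by rewrite nth' // take' ?(ltnW hs) //; apply/allP.
  rewrite nth' ?take' //; [exact: (ls_order H) | lia | lia].
- by move=> u hu; rewrite !upd2E /= (ls_par H).
- move=> u hu; rewrite !upd2E /= D'take countD; case: (eqVneq u p) => [->|up].
    by rewrite vp; move: cntp countD' cnt_le; case: (p == m) => /=; lia.
  by rewrite (negbTE (notin u up)) addn0 (ls_count H).
- by move=> x hx; rewrite !upd2E /= (ls_log H).
- move=> i hi; rewrite !upd2E /=; case: eqP => [E|N].
    by move: hi; rewrite /s' E; case: (z); rewrite ?ltnn // nth_rcons ltnn eqxx.
  have hi' : i < size s by move: hi; rewrite /s'; case: (z); rewrite ?size_rcons; lia.
  by rewrite (ls_queue H) ?nth'.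
- move=> u hu; rewrite !upd2E /= D'take sumD; case: (eqVneq u p) => [->|up].
    by rewrite vp sump.
  by rewrite (negbTE (notin u up)) addn0 (ls_sum H).
- move=> u hu; rewrite !upd2E /= D'take keyD; case: (eqVneq u p) => [->|up].
    by rewrite vp keyp.
  by rewrite (negbTE (notin u up)) maxn0 (ls_key H).
- move=> u; rewrite D'take D'E !upd2E /=; case: eqP => [->//|_ /= hu].
  exact: (ls_len H).
- by rewrite !upd2E /= (ls_next H).
Qed.

(** * The last loop: positions and labels *)

Notation exponent := (exponent m par d B q).
Notation mantissa := (mantissa m par d B q).
Notation placed := (placed m rt par d B q).

Definition label_value (pos : nat -> nat) (v : nat) : nat :=
  (pos v * K + exponent v) * K + mantissa v.

(** The last [k] nodes of the queue are labeled. Labels overwrite array 0, so it still holds parents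
    only for the front part; array 7 keeps right ends because heavy children are aligned there. *)
Record labels_state (k : nat) (s : seq nat) (pos : nat -> nat)
    (F : nat -> nat -> nat) : Prop := {
  lb_uniq : uniq s;
  lb_size : size s = m;
  lb_lt : forall u, u \in s -> u < m;
  lb_order : forall i, i < m -> {subset children (nth 0 s i) <= take i s};
  lb_par : forall v, v \in take (m - k) s -> F 0 v = par v;
  lb_log : log_table m.+1.*2 F;
  lb_queue : forall i, i < m -> F 3 i = nth 0 s i;
  lb_key : forall u, u <= m -> F 5 u = key u;
  lb_len : forall u, u < m -> F 6 u = len u;
  lb_end : forall v, v \in drop (m - k) s -> F 7 v = pos v + len v;
  lb_end_dummy : F 7 m = len rt;
  lb_next_dummy : F 8 m = 0;
  lb_placed : placed (drop (m - k) s) pos (F 8);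
  lb_label : forall v, v \in drop (m - k) s -> F 0 v = 2 ^ b + label_value pos v
}.

Definition labels_inv (k : nat) (R : nat -> nat) (F : nat -> nat -> nat) : Prop :=
  (R 0 = m /\ R 1 = k) /\ exists s pos, labels_state k s pos F.

Lemma label_value_lt pos v : v < m -> pos v < m.*2 ->
  label_value pos v < 2 ^ b.
Proof.
move=> hv hp; apply: leq_trans K_W; rewrite /label_value.
have Bs : m < B by lia.
have e_lt : exponent v < K by apply: leq_ltn_trans (leq_subr _ _) (K_log (len_le_m hv)).
have m_lt : mantissa v < K := leq_trans (mantissa_lt tree q Bs v) K_q.
apply: (@leq_trans ((pos v).+1 * (K * K))); last by rewrite leq_mul2r hp orbT.
nia.
Qed.

Lemma labels_rule : for_rule B W m (marker_labels B q K b) labels_inv.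
Proof.
split=> [k R F [] //|k R F hk [[R0 R1] [s [pos H]]]].
have bs := B_small; have Bs : m < B by lia.
pose h := m - k.+1; have mk : m - k = h.+1 by rewrite /h; lia.
have hm : h < m by rewrite /h; lia.
have hs : h < size s by rewrite (lb_size H).
pose v := nth 0 s h; pose D := drop (m - k) s; pose p := par v.
have vs : v \in s by exact: mem_nth.
have vm : v < m := lb_lt H vs.
have pm : p <= m := par_le vm.
have dropD : drop h s = v :: D by rewrite (drop_nth 0 hs) /D mk.
have us := lb_uniq H.
have [vT vD] : v \notin take h s /\ v \notin D.
  have : uniq (take h s ++ v :: D) by rewrite -dropD cat_take_drop.
  by rewrite cat_uniq /= => /and4P[_ /norP[-> _] -> _].
have Dm : {subset D <= gtn m} by move=> u /mem_drop /(lb_lt H).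
have D'm : {subset v :: D <= gtn m} by move=> u; rewrite inE => /predU1P[->|/Dm].
have pD : v != rt -> p \in D.
  move=> v_rt; have hpm : p < m := rooted_par_lt tree vm v_rt.
  have ps : p \in s.
    have sub : {subset s <= iota 0 m} by move=> u /(lb_lt H); rewrite mem_iota.
    have sz : size (iota 0 m) <= size s by rewrite size_iota (lb_size H).
    by have [_ E] := uniq_min_size us sub sz; rewrite E mem_iota.
  have jm : index p s < m by rewrite -(lb_size H) index_mem.
  (* A parent comes after its children in the queue, so the reverse traversal has already placed
     it. *)
  have /(lb_order H jm) : v \in children (nth 0 s (index p s)).
    by rewrite nth_index // mem_children vm /=.
  rewrite in_take // /v index_uniq // => hj.
  rewrite -[p](nth_index 0 ps) /D mk -(subnKC hj) -nth_drop mem_nth //.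
  by rewrite size_drop (lb_size H); lia.
pose a := if v == rt then 0 else
          if heavy v then pos p + len p - len v else F 8 p.
pose next' := if heavy v then F 8 else upd (F 8) p (F 8 p + padded (len v)).
have placed' : placed (v :: D) (upd pos v a) (upd next' v a.+1).
  exact: (placed_cons tree Bs Dm (lb_placed H) vm vD pD).
have lev := len_le_m vm; have ler := len_le_m (rooted_lt tree).
have len0 := len_gt0 tree q Bs vm; have slv := slack_id (len v).
have a_le : a + len v <= m.*2.
  have := placed_le_root tree Bs D'm placed' (mem_head v D).
  by rewrite /upd eqxx => /leq_trans -> //.
have a_lt : a < m.*2 by lia.
have p_rt : v == rt -> p = m by move=> /eqP E; rewrite /p E (rooted_dummy tree).
have hvy_rt : v == rt -> heavy v by move=> /eqP ->; exact: heavy_root.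
(* The dummy ends at [len rt], so the root, its heavy child, gets position 0 by the general
   formula. *)
have endp : F 7 p <= m.*2 /\ (heavy v -> F 7 p - len v = a).
  rewrite /a; case: (boolP (v == rt)) => [v_rt|v_rt].
    rewrite (p_rt v_rt) (lb_end_dummy H); split=> // _.
    by rewrite (eqP v_rt) subnn.
  rewrite (lb_end H (pD v_rt)); split=> [|->//].
  by apply: leq_trans (placed_le_root tree Bs Dm (lb_placed H) (pD v_rt)) ler.
have nextp : F 8 p <= m.*2.
  case: (boolP (v == rt)) => [v_rt|v_rt]; first by rewrite (p_rt v_rt) (lb_next_dummy H).
  apply: leq_trans (placed_next_le tree Bs Dm (lb_placed H) (pD v_rt)) _.
  by apply: leq_trans (placed_le_root tree Bs Dm (lb_placed H) (pD v_rt)) ler.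
have [endp1 endp2] := endp.
have keyp : key p < B * B by exact: children_key_lt.
have newkey_lt := len_key_lt vm.
have lab_lt : label_value (upd pos v a) v < 2 ^ b.
  by apply: label_value_lt => //; rewrite /upd eqxx.
have lab_def : label_value (upd pos v a) v = (a * K + exponent v) * K + mantissa v.
  by rewrite /label_value /upd eqxx.
have e_le : exponent v < K.
  exact: leq_ltn_trans (leq_subr _ _) (K_log lev).
have m_le : mantissa v < K := leq_trans (mantissa_lt tree q Bs v) K_q.
have K_gt0 : 0 < K by lia.
have KW : K < 2 ^ W.
  have : K <= m.*2 * (K * K).
    by rewrite mulnA leq_pmull // muln_gt0 K_gt0 double_gt0; lia.
  by have : 0 < 2 ^ b; [rewrite expn_gt0 | lia].
have log_lt := K_log lev.
have lab_mul : a * K + exponent v <= (a * K + exponent v) * K by rewrite leq_pmulr.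
have hvy_mul x : x * heavy v <= x /\ x * ~~ heavy v <= x.
  by case: (heavy v); rewrite /= ?muln0 ?muln1.
have [end_mul _] := hvy_mul (F 7 p - len v); have [_ next_mul] := hvy_mul (F 8 p).
have [_ pad_mul] := hvy_mul (padded (len v)).
have pad_le : padded (len v) <= 4 * m by rewrite /padded; lia.
have qW : q < 2 ^ W by apply: leq_trans (ltn_expl q (isT : 1 < 2)) (ltnW q_W).
xconst.
xop (m - 1); first by [].
xop h; first by rewrite /h; lia.
xload h v; first by rewrite (lb_queue H).
xload v p; first by rewrite (lb_par H) // mk (take_nth 0 hs) mem_rcons mem_head.
xload v (len v); first by rewrite (lb_len H).
xload p (key p); first by rewrite (lb_key H).
xconst.
xop (len v * B); first by [].
xop (len v * B + v); first by [].
xop (heavy v : nat); first by [].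
xload p (F 7 p); first by [].
xop (F 7 p - len v); first by [].
xload p (F 8 p); first by [].
xop (~~ heavy v : nat); first by case: (heavy v).
xop ((F 7 p - len v) * heavy v); first by [].
xop (F 8 p * ~~ heavy v); first by [].
xop a.
  case: (boolP (heavy v)) endp2 => hvy /=.
    by move=> /(_ isT) ->; rewrite muln1 muln0 addn0.
  rewrite muln0 muln1 add0n /a (negbTE hvy) ifN //.
  by apply: contraNN hvy; exact: hvy_rt.
xconst.
xop (slack q (len v)); first by [].
xop (padded (len v)); first by [].
xop (padded (len v) * ~~ heavy v); first by [].
xop (F 8 p + padded (len v) * ~~ heavy v); first by [].
xstore p (F 8 p + padded (len v) * ~~ heavy v).
xop (a + len v); first by [].
xstore v (a + len v).
xop a.+1; first by rewrite addn1.
xstore v a.+1.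
xload (len v) (trunc_log 2 (len v)).
  by rewrite !upd2E /= (lb_log H) //; lia.
xconst.
xop (exponent v); first by [].
xop (len v).-1; first by rewrite subn1.
xop (mantissa v); first by [].
xconst.
xop (a * K); first by [].
xop (a * K + exponent v); first by [].
xop ((a * K + exponent v) * K); first by [].
xop (label_value (upd pos v a) v); first by rewrite lab_def.
xconst.
xop (2 ^ b + label_value (upd pos v a) v); first by [].
xstore v (2 ^ b + label_value (upd pos v a) v).
xop k.+1; first by rewrite addn1.
split; first by split; read_regs.
have mv : (m == v) = false by apply/negbTE; rewrite neq_ltn vm orbT.
have neq u : u \in D -> (u == v) = false by move=> hu; apply: contraNF vD => /eqP <-.
exists s, (upd pos v a); split; rewrite -?/h.
- exact: us.
- exact: lb_size H.
- exact: lb_lt H.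
- exact: lb_order H.
- move=> u hu; rewrite !upd2E /=; case: eqP => [E|_]; first by rewrite -E hu in vT.
  by apply: (lb_par H); rewrite mk (take_nth 0 hs) mem_rcons inE hu orbT.
- by move=> x hx; rewrite !upd2E /= (lb_log H).
- by move=> i hi; rewrite !upd2E /= (lb_queue H).
- by move=> u hu; rewrite !upd2E /= (lb_key H).
- by move=> u hu; rewrite !upd2E /= (lb_len H).
- move=> u; rewrite dropD inE !upd2E /= /upd; case: eqP => [->//|_ /= hu].
  exact: (lb_end H).
- by rewrite !upd2E /= mv (lb_end_dummy H).
(* Cell [m] is written only when [v] is the root, and then 0 is added since the root is heavy. *)
- rewrite !upd2E /= mv; case: eqP => [E|_]; last exact: (lb_next_dummy H).
  have v_rt : v == rt.
    by apply: contraT => /(rooted_par_lt tree vm); rewrite -/p -E ltnn.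
  by rewrite -E (lb_next_dummy H) (hvy_rt v_rt) muln0.
- rewrite dropD; set N := (X in placed _ _ X).
  suff -> : N = upd next' v a.+1 by exact: placed'.
  apply: functional_extensionality => u; rewrite /N !upd2E /= /upd /next'.
  case: eqP => // _; case: (heavy v) => /=; rewrite ?muln0 ?muln1 ?addn0 //.
  by case: eqP => // ->.
- move=> u; rewrite dropD inE !upd2E /=; case: eqP => [->//|_ /= hu].
  by rewrite (lb_label H hu) /label_value /upd (neq u hu).
Qed.

(** The first two clauses are what [interval_test] asks of the positions. *)
Definition marker_post (R : nat -> nat) (F : nat -> nat -> nat) : Prop :=
  exists pos, [/\
    forall v, v < m -> v != rt ->
      pos (par v) < pos v /\ pos v + len v <= pos (par v) + len (par v),
    forall u v, u < m -> v < m -> u != rt -> v != rt -> u != v -> par u = par v ->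
      before m par d B q pos u v || before m par d B q pos v u,
    forall v, v < m -> label_value pos v < 2 ^ b
  & forall v, v < m -> F 0 v = 2 ^ b + label_value pos v].

Lemma marker_wps R F : R 0 = m -> R 1 = 0 -> (forall v, v < m -> F 0 v = par0 v) ->
  (forall j v, 0 < j -> v < B -> F j v = 0) ->
  wps (marker B q K b) marker_post R F.
Proof.
move=> R0 R1 F0 Fj; have bs := B_small; have Bs : m < B by lia.
have m_gt0 : 0 < m by have := rooted_lt tree; lia.
apply: wps_block; rewrite /marker_init.
xconst.
xstore m 1.
apply: wp_nil; apply: (wps_for (Inv := count_inv)).
- split; first by split; read_regs.
  split=> [v hv|u hu|x hx|j v hj hv]; rewrite upd2E /=.
  + by rewrite F0.
  + by rewrite addn0; case: eqP => // _; rewrite Fj //; lia.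
  (* The only entry required at the start is the logarithm of 1, which the zeroed memory already
     contains. *)
  + have -> : x = 1 by lia.
    by rewrite trunc_log1 Fj //; lia.
  + by case: j hj => [|[|j]] //= hj; rewrite Fj.
- exact: count_rule.
move=> R' F' [[R0' R1'] [H0 H1 H2 H3]].
apply: wps_block; xconst; xconst.
apply: wp_nil; apply: (wps_for (Inv := leaves_inv)).
- split; first by split; read_regs.
  split=> //.
  split=> // [v hv|u hu|j v hj hv]; first by rewrite H0 // hv.
    by rewrite H1 // size_filter.
  by apply: H3 => //; lia.
- exact: leaves_rule.
move=> {R' F' R0' R1' H0 H1 H2 H3} R' F' [[R0' R1'] [R5' HQ [H0 H1 H2 H3]]].
apply: wps_block; xconst.
apply: wp_nil; apply: (wps_for (Inv := lengths_inv)).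
- split; first by split; read_regs.
  exists (leaves m); first by read_regs.
  have B_gt0 : 0 < B by lia.
  split=> //.
  + exact/filter_uniq/iota_uniq.
  + by move=> u; rewrite mem_filter mem_iota => /andP[_ /andP[]].
  + move=> u hu; rewrite mem_filter mem_iota hu andbT take0.
    by case: (children u).
  + by move=> u hu; rewrite take0 H1 // (@eq_count _ _ pred0) // count_pred0 addn0.
  + by move=> u hu; rewrite H3 ?big_pred0 //; [move=> c; rewrite take0 | lia].
  + by move=> u hu; rewrite H3 ?big_pred0 //; [move=> c; rewrite take0 | lia].
  + by move=> u; rewrite take0.
  + exact: H3.
- exact: lengths_rule.
move=> {R' F' R0' R1' R5' HQ H0 H1 H2 H3} R' F' [[R0' R1'] [s R5' H]].
have ss : size s = m.
  by apply/eqP; rewrite eqn_leq (queue_size H) (ls_le H).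
have ts : take m s = s by rewrite -ss take_size.
have sub : {subset s <= iota 0 m} by move=> u /(ls_lt H); rewrite mem_iota.
have mem_s u : u < m -> u \in s.
  move=> hu; have sz : size (iota 0 m) <= size s by rewrite size_iota ss.
  by have [_ E] := uniq_min_size (ls_uniq H) sub sz; rewrite E mem_iota.
have keyE u : u <= m -> F' 5 u = key u.
  move=> hu; rewrite (ls_key H) // ts /key /max_key big_seq_cond [RHS]big_seq_cond.
  apply: eq_bigl => c; rewrite andbT mem_children andb_idr //.
  by move=> /andP[/mem_s].
have key_m : key m %/ B = len rt.
  rewrite (key_dummy tree) divnMDl ?divn_small ?addn0 //; last by lia.
  by have := rooted_lt tree; lia.
have lt_key : key m < B * B by exact: children_key_lt.
have ler := len_le_m (rooted_lt tree).
apply: wps_block; rewrite /marker_root.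
xload m (key m); first by rewrite keyE.
xconst.
xop (len rt); first by rewrite key_m.
xstore m (len rt).
xconst.
apply: wp_nil; apply: (wps_for (Inv := labels_inv)).
- split; first by split; read_regs.
  exists s, (fun=> 0).
  have dr : drop m s = [::] by rewrite -ss drop_size.
  split; rewrite ?subn0 ?dr ?ts.
  + exact: ls_uniq H.
  + exact: ss.
  + exact: ls_lt H.
  + exact: ls_order H.
  + by move=> v /(ls_lt H) hv; rewrite upd2E /= (ls_par H).
  + by move=> x hx; rewrite upd2E /= (ls_log H).
  + by move=> i hi; rewrite upd2E /= (ls_queue H) // ss.
  + by move=> u hu; rewrite upd2E /= keyE.
  + by move=> u hu; rewrite upd2E /= (ls_len H) // ts mem_s.
  + by [].
  + by rewrite upd2E !eqxx.
  + by rewrite upd2E /= (ls_next H).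
  + exact: placed_nil.
  + by [].
- exact: labels_rule.
move=> {R' F' R0' R1' R5' s H ss ts sub mem_s keyE} R' F' [_ [s [pos H]]].
change (marker_post (upd R' 19 0) F').
have mem_s u : u < m -> u \in s.
  move=> hu; have sz : size (iota 0 m) <= size s by rewrite size_iota (lb_size H).
  have sub : {subset s <= iota 0 m} by move=> x /(lb_lt H); rewrite mem_iota.
  by have [_ E] := uniq_min_size (lb_uniq H) sub sz; rewrite E mem_iota.
have sm : {subset s <= gtn m} by move=> u /(lb_lt H).
have := lb_placed H; rewrite subnn drop0 => P.
exists pos; split.
- by move=> v /mem_s; exact: (placed_nested tree Bs sm P).
- by move=> u v /mem_s hu /mem_s hv; exact: (placed_before tree Bs sm P).
- move=> v hv; apply: label_value_lt => //.
  have := placed_le_root tree Bs sm P (mem_s v hv).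
  by have := len_gt0 tree q Bs hv; lia.
- by move=> v hv; apply: (lb_label H); rewrite subnn drop0 mem_s.
Qed.

End Marker.

(** * Bit strings and the decoder *)

Fixpoint bits (b x : nat) : bitseq :=
  if b is b'.+1 then rcons (bits b' x./2) (odd x) else [::].

Lemma size_bits b x : size (bits b x) = b.
Proof. by elim: b x => //= b IH x; rewrite size_rcons IH. Qed.

Lemma code_rcons l c : code (rcons l c) = (code l).*2 + c.
Proof. by rewrite /code -cats1 foldl_cat. Qed.

Lemma code_bits b x : x < 2 ^ b -> code (bits b x) = 2 ^ b + x.
Proof.
elim: b x => [|b IH] x; first by rewrite expn0 ltnS leqn0 => /eqP ->.
move=> hx; rewrite /= code_rcons IH; last by move: hx; rewrite expnS; lia.
by rewrite expnS; lia.
Qed.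

Lemma code_lt l : code l < 2 ^ (size l).+1.
Proof.
elim/last_ind: l => // l c IH; rewrite code_rcons size_rcons expnS.
by move: IH; case: c; lia.
Qed.

(** The outer [<] compares two booleans: it holds when the left one is false and the right one true,
    which saves the machine a negation and a conjunction. *)
Definition decode_codes (K x y : nat) : bool :=
  let a := x %/ K %/ K in
  let a' := y %/ K %/ K in
  (x %% K < (a' - a) %/ 2 ^ (x %/ K %% K)) < (a < a').

Definition decoder (K : nat) : seq ainstr := [::
  AConst 2 K; AOp OMod 3 0 2; AOp ODiv 4 0 2; AOp OMod 5 4 2; AOp ODiv 4 4 2;
  AOp ODiv 6 1 2; AOp ODiv 6 6 2; AOp OLt 7 4 6; AOp OSub 8 6 4; AOp OShr 8 8 5;
  AOp OLt 8 3 8; AOp OLt 0 8 7].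

(** The leading 1 of a code contributes a multiple of [K * K]. It shifts both positions by the same
    [Z], which the comparison and the difference cancel. *)
Lemma decode_codesE K Z a e x a' e' x' : e < K -> x < K -> e' < K -> x' < K ->
  decode_codes K (Z * (K * K) + ((a * K + e) * K + x))
    (Z * (K * K) + ((a' * K + e') * K + x')) =
  (a < a') && ((a' - a) %/ 2 ^ e <= x).
Proof.
move=> he hx he' hx'; have K_gt0 : 0 < K by exact: leq_ltn_trans he.
have E c f y : Z * (K * K) + ((c * K + f) * K + y) = ((Z + c) * K + f) * K + y by nia.
rewrite /decode_codes !E.
have D c f : f < K -> (c * K + f) %/ K = c.
  by move=> hf; rewrite divnMDl // divn_small // addn0.
rewrite !D // !modnMDl (modn_small hx) (modn_small he).
by rewrite subnDl ltn_add2l; case: (leqP (_ %/ _) x); case: (a < a').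
Qed.

Lemma decoder_wps B W N K R F : 0 < W -> K < 2 ^ W -> R 0 < 2 ^ W -> R 1 < 2 ^ W ->
  wps B W N [:: Block (decoder K)]
    (fun R' _ => R' 0 = decode_codes K (R 0) (R 1)) R F.
Proof.
move=> W_gt0 hK h0 h1; apply: wps_block; rewrite /decoder.
have bool_lt (c : bool) : c < 2 ^ W.
  by apply: leq_ltn_trans (leq_b1 c) _; rewrite -{1}(expn0 2) ltn_exp2l.
have div_lt x y : x < 2 ^ W -> x %/ y < 2 ^ W by exact: leq_ltn_trans (leq_div _ _).
have mod_lt x y : x < 2 ^ W -> x %% y < 2 ^ W by exact: leq_ltn_trans (leq_mod _ _).
set a := R 0 %/ K %/ K; set a' := R 1 %/ K %/ K.
have ha' : a' < 2 ^ W by exact/div_lt/div_lt.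
have hd : a' - a < 2 ^ W by exact: leq_ltn_trans (leq_subr _ _) ha'.
set s := (a' - a) %/ 2 ^ (R 0 %/ K %% K).
have hs : s < 2 ^ W by exact: div_lt.
apply: wp_const => //.
apply: (@wp_op _ _ (R 0 %% K)); [by [] | exact: mod_lt | ].
apply: (@wp_op _ _ (R 0 %/ K)); [by [] | exact: div_lt | ].
apply: (@wp_op _ _ (R 0 %/ K %% K)); [by [] | exact/mod_lt/div_lt | ].
apply: (@wp_op _ _ a); [by [] | exact/div_lt/div_lt | ].
apply: (@wp_op _ _ (R 1 %/ K)); [by [] | exact: div_lt | ].
apply: (@wp_op _ _ a'); [by [] | by [] | ].
apply: (@wp_op _ _ (a < a')); [by [] | exact: bool_lt | ].
apply: (@wp_op _ _ (a' - a)); [by [] | by [] | ].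
apply: (@wp_op _ _ s); [by [] | by [] | ].
apply: (@wp_op _ _ (R 0 %% K < s)); [by [] | exact: bool_lt | ].
apply: (@wp_op _ _ (decode_codes K (R 0) (R 1))); [by [] | exact: bool_lt | ].
by apply: wp_nil; read_regs.
Qed.

(** * The scheme *)

Section TreeOfRtree.

Variable T : rtree.
Let m := nnodes T.

(** The default 0 outside the tree matches the memory in [marker_input]. *)
Definition tree_parent (v : nat) : nat :=
  if insub v is Some u then val (parent (r := T) u) else 0.
Definition tree_par (v : nat) : nat :=
  if tree_parent v == v then m else tree_parent v.
Definition tree_depth (v : nat) : nat :=
  if insub v is Some u then findex (@parent T) u (troot T) else 0.

Lemma tree_parentE (u : 'I_m) : tree_parent u = parent u.
Proof. by rewrite /tree_parent valK. Qed.

Lemma tree_depthE (u : 'I_m) : tree_depth u = findex (@parent T) u (troot T).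
Proof. by rewrite /tree_depth valK. Qed.

Lemma depth_parent (u : 'I_m) : u != troot T ->
  tree_depth u = (tree_depth (parent u)).+1.
Proof.
by move=> hu; rewrite !tree_depthE fconnect_findex ?reach_root // eq_sym.
Qed.

Lemma tree_par_nonroot (u : 'I_m) : u != troot T -> tree_par u = parent u.
Proof.
move=> hu; rewrite /tree_par tree_parentE; case: eqP => // /val_inj E.
by have := depth_parent hu; rewrite E => /n_Sn.
Qed.

Lemma rtree_rooted : rooted m (troot T) tree_par tree_depth.
Proof.
split.
- exact: ltn_ord.
- by rewrite /tree_par tree_parentE parent_root eqxx.
- by rewrite tree_depthE findex0.
- move=> v hv v_rt; rewrite -[v]/(val (Ordinal hv)) tree_par_nonroot; last exact: v_rt.
  exact: ltn_ord.
- move=> v hv v_rt; rewrite -[v]/(val (Ordinal hv)) tree_par_nonroot; last exact: v_rt.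
  exact: depth_parent.
Qed.

Lemma belowE (u v : 'I_m) : below tree_par tree_depth u v = fconnect (@parent T) v u.
Proof.
suff H w : w < m -> forall hw : w < m,
    below tree_par tree_depth u w = fconnect (@parent T) (Ordinal hw) u.
  by have := H v (ltn_ord v) (ltn_ord v); rewrite (_ : Ordinal _ = v) //; apply: val_inj.
move: w; apply: (top_down_ind rtree_rooted) => [hr|w hw w_rt IH hw'].
  have -> : Ordinal hr = troot T by apply: val_inj.
  rewrite (below_root rtree_rooted).
  apply/eqP/idP => [/val_inj ->|/iter_findex <-]; first exact: connect0.
  by elim: (findex _ _ _) => // k; rewrite iterSr parent_root.
rewrite (below_par rtree_rooted) // fconnect_eqVf [Ordinal hw' == u]eq_sym.
have E : tree_par w = parent (Ordinal hw') by rewrite -tree_par_nonroot.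
congr (_ || _); have hp : tree_par w < m by rewrite E ltn_ord.
by rewrite (IH hp); congr (connect _ _ _); apply: val_inj; rewrite /= E.
Qed.

End TreeOfRtree.

(** Exponent and mantissa take [clog2log2 n + 3] bits each; the other
    [clog2 n + 4 * clog2log2 n + 1] bits hold the position. *)
Definition label_bits (n : nat) := clog2 n + 6 * clog2log2 n + 7.
Definition slack_bits (n : nat) := clog2log2 n + 2.
Definition field_base (n : nat) := 2 ^ (clog2log2 n + 3).
(** As [clog2log2 n <= clog2 n] and [clog2 n] is positive, codes of labels take at most
    [15 * clog2 n] bits. *)
Definition word_bits (n : nat) := 20 * clog2 n.

(** * Inequalities between the parameters *)

Section Sizes.

Variable n : nat.
Hypothesis n_gt1 : 1 < n.
Let L := clog2 n.
Let p := clog2log2 n.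
Let B := 8 * n.
Let q := slack_bits n.
Let K := field_base n.
Let b := label_bits n.
Let W := word_bits n.

Lemma param_L : 0 < L.
Proof. by rewrite up_log_gt0. Qed.

Lemma param_n : n <= 2 ^ L.
Proof. exact: up_logP. Qed.

Lemma param_p : L <= 2 ^ p.
Proof. exact: up_logP. Qed.

Lemma param_p_le : p <= L.
Proof. by apply: up_log_min => //; apply/ltnW/ltn_expl. Qed.

Lemma param_B : 16 <= B /\ B * B <= 2 ^ W.
Proof.
split; first by rewrite /B; lia.
have h : B <= 2 ^ (3 + L) by rewrite expnD leq_mul2l param_n orbT.
apply: leq_trans (leq_mul h h) _; rewrite -expnD leq_exp2l //.
by have := param_L; rewrite /W /word_bits -/L; lia.
Qed.

Lemma param_q : 2 ^ q < 2 ^ W.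
Proof.
rewrite ltn_exp2l // /q /slack_bits -/p /W /word_bits -/L.
by have := param_L; have := param_p_le; lia.
Qed.

Lemma param_b : (2 ^ b).*2 <= 2 ^ W.
Proof.
rewrite -mul2n -expnS leq_exp2l // /b /label_bits /W /word_bits -/L -/p.
by have := param_L; have := param_p_le; lia.
Qed.

Lemma param_Kq : 2 ^ q.+1 <= K.
Proof. by rewrite leq_exp2l // /q /slack_bits; lia. Qed.

Lemma param_Kb : 2 ^ b = 2 ^ (L + 4 * p + 1) * (K * K).
Proof. by rewrite -!expnD; congr (2 ^ _); rewrite /b /label_bits -/L -/p; lia. Qed.

Lemma param_KW : K < 2 ^ W.
Proof.
rewrite ltn_exp2l // /W /word_bits -/L -/p.
by have := param_L; have := param_p_le; lia.
Qed.

Variable m : nat.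
Hypothesis m_le : m <= n.

Lemma param_m_lt : 4 * m < B.
Proof. by rewrite /B; lia. Qed.

Lemma param_len rt par d : rooted m rt par d ->
  forall v, v < m -> len m par d B q v <= m.*2.
Proof.
(* Here [Q = 2 ^ p.+1] is half of [2 ^ q], and [L <= 2 ^ p] makes it exceed [L]. *)
move=> tree v hv; apply: (@len_le _ _ _ _ tree _ _ _ L (2 ^ p.+1)) => //.
- by have := param_m_lt; lia.
- exact: leq_trans param_n.
- by rewrite /q /slack_bits -/p addn2 expnS mul2n.
- by have := param_p; rewrite expnS; have := expn_gt0 2 p; lia.
Qed.

Lemma param_K : m.*2 * (K * K) <= 2 ^ b.
Proof.
rewrite /K /field_base -/p -expnD -mul2n.
apply: (@leq_trans (2 ^ L.+1 * 2 ^ (p + 3 + (p + 3)))).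
  by apply: leq_mul => //; rewrite expnS leq_mul2l (leq_trans m_le param_n).
by rewrite -expnD leq_exp2l // /b /label_bits -/L -/p; lia.
Qed.

Lemma param_log x : x <= m.*2 -> trunc_log 2 x < K.
Proof.
have K8 : 8 * 2 ^ p = K by rewrite /K /field_base -/p expnD mulnC.
case: (posnP x) => [-> _|x_gt0 hx]; first by rewrite trunc_log0 expn_gt0.
have : 2 ^ trunc_log 2 x <= 2 ^ L.+1.
  apply: leq_trans (trunc_logP _ x_gt0) _ => //; apply: leq_trans hx _.
  by rewrite expnS mul2n leq_double (leq_trans m_le param_n).
rewrite leq_exp2l //; have := param_p; have := expn_gt0 2 p; lia.
Qed.

End Sizes.

Section Scheme.

Variable n : nat.
Hypothesis n_gt1 : 1 < n.

Let B := 8 * n.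
Let W := word_bits n.
Let b := label_bits n.
Let K := field_base n.

Definition marker_program : program :=
  compile B 0 (marker B (slack_bits n) K b).
Definition decoder_program : program := compile B 0 [:: Block (decoder K)].

Definition scheme : labeling_scheme :=
  LabelingScheme
    (fun T v => bits b (memory (run W marker_program (1000 * nnodes T)
                                    (marker_input W T)) v - 2 ^ b))
    (fun l1 l2 => decode_codes K (code l1) (code l2)).

(** The parameters occur only as constants inside instructions, so the size evaluates with [n] left
    symbolic. *)
Lemma marker_size : size marker_program <= 500.
Proof. by []. Qed.

Lemma decoder_size : size decoder_program <= 500.
Proof. by []. Qed.

Definition input_regs (m : nat) : nat -> nat := fun r => if r == 0 then m else 0.
Definition input_cells (T : rtree) : nat -> nat -> nat :=
  fun j v => tree_parent T (j * B + v).

Lemma marker_inputE (T : rtree) w : nnodes T <= n -> W <= w ->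
  marker_input w T = Config 0 (input_regs (nnodes T)) (flat B (input_cells T)).
Proof.
move=> hT hw; have [B16 BW] := param_B n_gt1.
have small x : x <= nnodes T -> word w x = x.
  move=> hx; apply: word_small hw _; apply: leq_trans BW; rewrite -/B; nia.
rewrite /marker_input small //; congr Config; apply: functional_extensionality => a.
rewrite /flat /input_cells -divn_eq /tree_parent; case: insubP => // u _ _.
by rewrite small // ltnW.
Qed.

Lemma marker_correct (T : rtree) : nnodes T <= n ->
  exists pos c', [/\
    forall w, W <= w ->
      run w marker_program (1000 * nnodes T) (marker_input w T) = c',
    halted marker_program c',
    forall v : 'I_(nnodes T),
      memory c' v = 2 ^ b + label_value (nnodes T) (tree_par T) (tree_depth T) B
                              (slack_bits n) K pos v,
    forall v : 'I_(nnodes T), label_value (nnodes T) (tree_par T) (tree_depth T) B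
                              (slack_bits n) K pos v < 2 ^ b
  & forall u v : 'I_(nnodes T),
      (pos u < pos v) &&
      ((pos v - pos u) %/ 2 ^ exponent (nnodes T) (tree_par T) (tree_depth T) B
          (slack_bits n) u <=
        mantissa (nnodes T) (tree_par T) (tree_depth T) B (slack_bits n) u) =
      ancestor u v].
Proof.
move=> hT; have [B16 BW] := param_B n_gt1; have mB := param_m_lt n_gt1 hT.
rewrite -/B -/W in mB B16 BW.
have tree := rtree_rooted T; have Bs : nnodes T < B by lia.
have bs : 9 * B <= 2 ^ W by apply: leq_trans BW; rewrite leq_mul2r orbC; lia.
have W_gt0 : 0 < W by have := param_L n_gt1; rewrite /W /word_bits; lia.
have par0_lt v : v < nnodes T -> tree_parent T v < nnodes T.
  by move=> hv; rewrite -[v]/(val (Ordinal hv)) tree_parentE ltn_ord.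
have mT : 0 < nnodes T by have := rooted_lt tree; lia.
have post := @marker_wps _ _ _ _ _ tree par0_lt (fun v _ => erefl) _ _ _ _ _ mB B16 BW
  (param_q n_gt1) (param_K n_gt1 hT) (param_b n_gt1) (param_log n_gt1 hT)
  (param_Kq n_gt1) (param_len n_gt1 hT tree) (input_regs (nnodes T)) (input_cells T)
  erefl erefl (fun v _ => erefl).
(* All arrays but the first start at address [B] or later, beyond the nodes of the tree. *)
have zero j v : 0 < j -> v < B -> input_cells T j v = 0.
  move=> hj hv; rewrite /input_cells /tree_parent insubN //; nia.
(* A tree has at least its root, so [(nnodes T).+1] is at most twice [nnodes T]. *)
have ht : size marker_program * (nnodes T).+1 <= 1000 * nnodes T.
  by have := marker_size; nia.
have [R' [F' [[pos [H1 H2 H3 H4]] r halt]]] := program_sound bs W_gt0 (post zero) ht.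
exists pos, (Config (size marker_program) R' (flat B F')); split=> //.
- by move=> w hw; rewrite marker_inputE // r.
- move=> v; have vB : v < B := ltn_trans (ltn_ord v) Bs.
  by have := flat_arr F' 0 vB; rewrite mul0n add0n /= => ->; apply: H4.
- by move=> v; apply: H3.
- move=> u v; rewrite (interval_test tree Bs H1 H2) // belowE.
  by rewrite /ancestor val_eqE.
Qed.

Lemma scheme_label (T : rtree) c' (v : 'I_(nnodes T)) x :
  (forall w, W <= w -> run w marker_program (1000 * nnodes T) (marker_input w T) = c') ->
  memory c' v = 2 ^ b + x -> x < 2 ^ b ->
  code (label scheme v) = 2 ^ b + x.
Proof. by move=> hr hm hx; rewrite /= hr // hm addKn code_bits. Qed.

Lemma scheme_ancestry : ancestry_scheme n scheme.
Proof.
move=> T hT u v; have [pos [c' [hr _ hm hl hanc]]] := marker_correct hT.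
have tree := rtree_rooted T.
have Bs : nnodes T < B by rewrite /B; lia.
have fields (w : 'I_(nnodes T)) :
    exponent (nnodes T) (tree_par T) (tree_depth T) B (slack_bits n) w < K /\
    mantissa (nnodes T) (tree_par T) (tree_depth T) B (slack_bits n) w < K.
  split; last exact: leq_trans (mantissa_lt tree _ Bs w) (param_Kq n_gt1).
  apply: leq_ltn_trans (leq_subr _ _) (param_log n_gt1 hT _).
  exact: (param_len n_gt1 hT tree).
have [eu mu] := fields u; have [ev mv] := fields v.
rewrite -hanc /decode /=.
rewrite -/(label scheme u) -/(label scheme v).
rewrite (scheme_label hr (hm u) (hl u)) (scheme_label hr (hm v) (hl v)).
by rewrite /b param_Kb // -/K /label_value decode_codesE.
Qed.

Lemma size_label (T : rtree) (v : 'I_(nnodes T)) : size (label scheme v) = b.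
Proof. exact: size_bits. Qed.

Lemma connect_ord0 (v : 'I_1) : fconnect id v ord0.
Proof. by rewrite ord1; exact: connect0. Qed.

Lemma scheme_size : has_label_size n scheme b.
Proof.
split=> [l [T _ [u ->]]|]; first by rewrite size_label.
(* All labels have length [b], so the tree with a single node shows that the maximum is attained. *)
pose T1 : rtree := @RTree 1 ord0 id erefl connect_ord0.
exists (label scheme (troot T1)); last exact: size_label.
by exists T1; [exact: ltnW | exists (troot T1)].
Qed.

Lemma decoder_time w : W <= w -> decoder_runs_in w n scheme decoder_program 1000.
Proof.
move=> hw l1 l2 [T1 _ [u1 ->]] [T2 _ [u2 ->]].
have small T (u : 'I_(nnodes T)) : code (label scheme u) < 2 ^ W.
  apply: leq_trans (code_lt _) _; rewrite size_label expnS mul2n.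
  exact: param_b.
set x1 := code (label scheme u1); set x2 := code (label scheme u2).
have [B16 BW] := param_B n_gt1; rewrite -/B -/W in B16 BW.
have bs : 9 * B <= 2 ^ W by apply: leq_trans BW; rewrite leq_mul2r orbC; lia.
have W_gt0 : 0 < W by have := param_L n_gt1; rewrite /W /word_bits; lia.
pose R r := match r with 0 => x1 | 1 => x2 | _ => 0 end.
(* The decoder has no loop; the iteration count 1 gives a time bound of twice the program size. *)
have hwp := @decoder_wps B W 1 K R (fun _ _ => 0) W_gt0
  (param_KW n_gt1) (small _ u1) (small _ u2).
have ht : size decoder_program * 2 <= 1000 by have := decoder_size; lia.
have [R' [F' [hR r halt]]] := program_sound bs W_gt0 hwp ht.
have -> : decoder_input w (label scheme u1) (label scheme u2) =
    Config 0 R (flat B (fun _ _ => 0)).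
  by rewrite /decoder_input !(word_small hw (small _ _)).
by rewrite (r w hw); split.
Qed.

Lemma marker_time w : W <= w ->
  marker_runs_in w n scheme marker_program (fun m => 1000 * m).
Proof.
move=> hw T hT; have [pos [c' [hr hh hm hl _]]] := marker_correct hT.
rewrite /= hr //; split=> // v.
by rewrite -/(label scheme v) (scheme_label hr (hm v) (hl v)) hm.
Qed.

End Scheme.

Theorem theorem1 :
  exists k c : nat,
  forall n : nat, 2 <= n ->
  exists (A : labeling_scheme) (M D : program),
    [/\ ancestry_scheme n A,
        has_label_size n A (clog2 n + 6 * clog2log2 n + 7),
        size M <= c /\ size D <= c
      & forall w : nat, k * clog2 n <= w ->
          decoder_runs_in w n A D c /\
          marker_runs_in w n A M (fun m => c * m)].
Proof.
(* 20 is the factor in [word_bits]; 1000 is twice the bound 500 on the program sizes. *)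
exists 20, 1000 => n n_gt1.
exists (scheme n), (marker_program n), (decoder_program n); split.
- exact: scheme_ancestry.
- exact: scheme_size.
- by split; [have := marker_size n | have := decoder_size n]; lia.
- by move=> w hw; split; [exact: decoder_time | exact: marker_time].
Qed.
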